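(* Let $G$ be a non-elementary group admitting an SCC (statistically convex-cocompact) action on a proper geodesic metric space $(\mathrm Y,d)$ with a contracting element, and let $\mathcal{NC}\subset G$ be the set of non-contracting elements. Then the growth rate of conjugacy classes of non-contracting elements is strictly less than $\omega(G)$, i.e. $\omega^c(\mathcal{NC})<\omega(G)$.
   Context: Setting: $G$ is a countable group acting properly by isometries on a proper geodesic metric space $(\mathrm Y,d)$; $o\in \mathrm Y$ is a fixed basepoint. $G$ is non-elementary if it has no finite-index cyclic subgroup. $B(y,r)$ is the ball of radius $r$, $N_r(A)$ is the $r$-neighborhood of $A$. Growth: $N(o,n)=\{g\in G: d(o,go)\le n\}$; for $\Gamma\subset G$, $\omega(\Gamma)=\limsup_{n\to\infty}\frac{\log \sharp(N(o,n)\cap\Gamma)}{n}$. For $g\in G$ let $[g]$ be its conjugacy class and $\ell^o([g])=\min\{d(o,g'o):g'\in[g]\}$. For $X\subset G$ the growth rate of conjugacy classes is $\omega^c(X)=\limsup_{n\to\infty}\frac{\log\sharp\{[g]:g\in X,\ \ell^o([g])\le n\}}{n}$. Contracting elements: for $X\subset \mathrm Y$ and $y\in\mathrm Y$, $\pi_X(y)$ is the set of $x\in X$ with $d(y,x)=d(y,X)$, and $\pi_X(A)=\bigcup_{a\in A}\pi_X(a)$. For $C\ge 1$, $X$ is $C$-contracting if every geodesic $\gamma$ with $d(\gamma,X)\ge C$ satisfies $\mathrm{diam}(\pi_X(\gamma))\le C$; $X$ is contracting if it is $C$-contracting for some $C$. An element $h\in G$ is contracting if $\langle h\rangle\cdot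 o$ is a contracting subset and $n\in\mathbb Z\mapsto h^no\in\mathrm Y$ is a quasi-isometric embedding. SCC: for $0\le M_1\le M_2$, $\mathcal O_{M_1,M_2}$ is the set of $g\in G$ for which there is a geodesic $\gamma$ between a point of $B(o,M_2)$ and a point of $B(go,M_2)$ whose interior lies outside $N_{M_1}(Go)$. The (proper) action is SCC if there are $M_1,M_2>0$ with $\omega(\mathcal O_{M_1,M_2})<\omega(G)$. *)

(* Defs.v *)
From HB Require Import structures.
From mathcomp Require Import all_boot all_order all_algebra.
From mathcomp Require Import all_classical all_reals all_analysis.

Set Implicit Arguments.
Unset Strict Implicit.
Unset Printing Implicit Defensive.

Import Order.TTheory GRing.Theory Num.Theory.
Import numFieldNormedType.Exports.

Local Open Scope classical_set_scope.
Local Open Scope ring_scope.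

Section Groups.
Variable G : groupType.
Implicit Types (g h : G) (H : set G).

Definition zexpg g (n : int) : G :=
  match n with
  | Posz k => (g ^+ k)%g
  | Negz k => (g ^- k.+1)%g
  end.

Definition cyclic_subgroup g : set G := range (zexpg g).

Definition lcoset_set H g : set G := [set (g * h)%g | h in H].

Definition finite_index H : Prop := finite_set (range (lcoset_set H)).

Definition non_elementary : Prop :=
  ~ exists g, finite_index (cyclic_subgroup g).

Definition conj_class g : set G := range (conjg g).

End Groups.

Section Metric.
Context {R : realType} {Y : metricType R}.
Implicit Types (x y : Y) (X A B : set Y) (C r L : R) (gamma : R -> Y).

(* The library's [closed_ball] is the closure of the open ball, which in a
   general metric space can be smaller than this set. *)
Definition cball y r : set Y := [set z | mdist y z <= r].

Definition set_edist A B : \bar R :=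
  ereal_inf [set (mdist a b)%:E | a in A & b in B].

Definition nbhd r A : set Y := [set y | (set_edist [set y] A <= r%:E)%E].

(* With this definition the diameter of the empty set is -oo; diameters only
   occur in bounds [diam A <= C] with 1 <= C. *)
Definition diam A : \bar R :=
  ereal_sup [set (mdist a b)%:E | a in A & b in A].

Definition proper_space : Prop := forall y r, compact (cball y r).

(* A geodesic is a path [gamma] parametrized by arc length on [0, L]; its
   values outside [0, L] are irrelevant. *)
Definition is_geodesic L gamma : Prop :=
  0 <= L /\
  forall s t, s \in `[0, L] -> t \in `[0, L] ->
    mdist (gamma s) (gamma t) = `|s - t|.

Definition geodesic_arc L gamma : set Y := gamma @` `[0, L].

Definition geodesic_interior L gamma : set Y := gamma @` `]0, L[.

Definition geodesic_space : Prop :=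
  forall x y, exists L gamma,
    [/\ is_geodesic L gamma, gamma 0 = x & gamma L = y].

Definition nearest_proj X y : set Y :=
  [set x | X x /\ (mdist y x)%:E = set_edist [set y] X].

Definition set_proj X A : set Y := \bigcup_(a in A) nearest_proj X a.

Definition C_contracting C X : Prop :=
  forall L gamma, is_geodesic L gamma ->
    (C%:E <= set_edist (geodesic_arc L gamma) X)%E ->
    (diam (set_proj X (geodesic_arc L gamma)) <= C%:E)%E.

Definition contracting_set X : Prop :=
  exists C, 1 <= C /\ C_contracting C X.

Definition quasi_isometric_embedding (f : int -> Y) : Prop :=
  exists lambda c : R, [/\ 1 <= lambda, 0 <= c &
    forall m n : int,
      lambda^-1 * `|m - n|%:~R - c <= mdist (f m) (f n) <=
      lambda * `|m - n|%:~R + c].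

End Metric.

Arguments proper_space {R} Y.
Arguments geodesic_space {R} Y.

Section Actions.
Context {R : realType}.

Record isometric_action (G : groupType) (Y : metricType R) := IsometricAction {
  act :> G -> Y -> Y;
  act1 : forall y, act 1%g y = y;
  actM : forall g h y, act (g * h)%g y = act g (act h y);
  act_isometry : forall g x y, mdist (act g x) (act g y) = mdist x y
}.

Variables (G : groupType) (Y : metricType R).
Implicit Types (a : isometric_action G Y) (o : Y) (g h : G).

Definition proper_action a : Prop :=
  forall K : set Y, compact K -> finite_set [set g | (a g @` K) `&` K !=set0].

Definition orbit_set a o (H : set G) : set Y := [set a g o | g in H].

(* [lne 0 = -oo], and [counting] is +oo on infinite sets. *)
Definition growth (T : choiceType) (A : nat -> set T) : \bar R :=
  limn_esup (fun n => (lne (counting (A n)) * (n%:R^-1)%:E)%E).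

Definition orbit_ball a o (n : nat) : set G :=
  [set g | mdist o (a g o) <= n%:R].

Definition omega a o (Gamma : set G) : \bar R :=
  growth (fun n => orbit_ball a o n `&` Gamma).

(* The infimum is attained when the action is proper and [Y] is proper. *)
Definition conj_length a o (c : set G) : R :=
  inf [set mdist o (a g o) | g in c].

Definition omega_conj a o (X : set G) : \bar R :=
  growth (fun n =>
    [set c | (exists2 g, X g & c = conj_class g) /\
             conj_length a o c <= n%:R]).

Definition contracting_element a o h : Prop :=
  contracting_set (orbit_set a o (cyclic_subgroup h)) /\
  quasi_isometric_embedding (fun n : int => a (zexpg h n) o).

Definition concave_region a o (M1 M2 : R) : set G :=
  [set g | exists (L : R) (gamma : R -> Y),
    [/\ is_geodesic L gamma,
        cball o M2 (gamma 0), cball (a g o) M2 (gamma L) &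
        geodesic_interior L gamma `&` nbhd M1 (orbit_set a o [set: G]) = set0]].

Definition SCC a o : Prop :=
  exists M1 M2 : R, [/\ 0 < M1, M1 <= M2 &
    (omega a o (concave_region a o M1 M2) < omega a o [set: G])%E].

Definition non_contracting a o : set G :=
  [set g | ~ contracting_element a o g].

End Actions.

(* Main.v *)
Require Import Defs.
From mathcomp Require Import all_boot all_order all_algebra.
From mathcomp Require Import all_classical all_reals all_analysis.
From mathcomp Require Import finmap ring lra zify.

(** Write X for the orbit of o under the cyclic group of a contracting element,
    E for the elements that move X to a set at bounded Hausdorff distance, and
    w for the growth rate of G. A barrier of g is a translate of X on which the
    projections of o and g o are far apart, and g is barrier-free at level K if
    no translate separates them by more than K. The proof shows that a
    non-contracting conjugacy class has a barrier-free representative or one in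
    E, of almost minimal length, and that both kinds of elements grow strictly
    slower than G.

    Contraction is used mostly through an inequality ([gated_contracts]): either
    two points have close projections to X, or their distance is, up to a
    constant, the length of the detour along X. This gives the Behrstock
    inequality [behrstock] for two translates, and properness gives the dichotomy
    [parallel_or_bounded]: an element is in E or moves X to a set with bounded
    projection to X. [barrier_axis] collects these facts, and [axis_barrier]
    proves them and the linear growth of E.

    A shortest element g of its class that has a deep barrier is in E up to
    conjugacy or contracting ([shortest_trichotomy]). Indeed, minimality prevents
    the translates of the barrier by powers of g from undoing each other's
    progress, so by the Behrstock inequality they are linearly ordered, and any
    geodesic that projects far along the orbit of g has to come close to this
    orbit ([chain_contracting]).

    Barrier-free elements are growth tight ([barrier_free_growth]). Inserting
    between barrier-free letters a power f of the contracting element, longer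
    than the barrier level, gives words whose first letter is determined up to a
    bounded error by the product ([word_first_close]), because another first
    letter would contain the barrier f. Comparing with the Poincare series of G
    at exponents s > w bounds the series of the barrier-free elements uniformly,
    hence also at w ([barrier_free_series]). A geodesic from o to g o with g
    barrier-free is cut into pieces of length about T: an almost barrier-free
    element followed by an element of the concave region ([thick_step]). The
    series of such pairs converges when the concave region is weighted with an
    exponent below w, so its tail can be made smaller than 1/2 by the choice of T,
    and still smaller than 1/2 after w is slightly decreased; the recursion
    [thick_count] then bounds the growth of barrier-free elements by an exponent
    below w. The same recursion without barriers shows that w is finite
    ([omega_finite]). *)

Set Implicit Arguments.
Unset Strict Implicit.
Unset Printing Implicit Defensive.

Import Order.TTheory GRing.Theory Num.Theory.

Local Open Scope classical_set_scope.
Local Open Scope ring_scope.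

(** * Contracting sets and nearest-point projections *)

Section NearestPoints.
Context {R : realType} {Y : metricType R}.
Implicit Types (X : set Y) (x y z p q : Y) (C L : R) (gamma : R -> Y).

Lemma mdist_sym x y : mdist x y = mdist y x.
Proof. exact: metric_sym. Qed.

Lemma mdist_triangle y x z : mdist x z <= mdist x y + mdist y z.
Proof. exact: metric_triangle. Qed.

Definition nearest X x p : Prop :=
  X p /\ forall q, X q -> mdist x p <= mdist x q.

Definition proximinal X : Prop := forall x, exists p, nearest X x p.

(** Strong contraction as a metric inequality: points with far apart
    projections are joined, up to [C], by the detour through their
    projections. *)
Definition contracts C X : Prop := forall x y p q,
  nearest X x p -> nearest X y q ->
  mdist p q <= C \/ mdist x p + mdist p q + mdist q y <= mdist x y + C.

(** Geodesics between points with far apart projections pass close to both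
    projections, in the right order. *)
Definition gated C X : Prop := forall L gamma, is_geodesic L gamma ->
  forall p q, nearest X (gamma 0) p -> nearest X (gamma L) q ->
  C < mdist p q ->
  exists s1 s2, [/\ 0 <= s1, s1 <= s2, s2 <= L,
    mdist (gamma s1) p <= C & mdist (gamma s2) q <= C].

Lemma geodesic_ge0 L gamma : is_geodesic L gamma -> 0 <= L.
Proof. by case. Qed.

Lemma geodesic_dist L gamma s t : is_geodesic L gamma ->
  0 <= s -> s <= t -> t <= L -> mdist (gamma s) (gamma t) = t - s.
Proof.
move=> [L0 H] s0 st tL; rewrite H ?in_itv/= ?s0 ?(le_trans s0 st) ?tL//.
  by rewrite distrC ger0_norm// subr_ge0.
by rewrite (le_trans st tL).
Qed.

Lemma geodesic_sub L gamma s t : is_geodesic L gamma ->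
  0 <= s -> s <= t -> t <= L -> is_geodesic (t - s) (fun u => gamma (s + u)).
Proof.
move=> [L0 H] s0 st tL; split; first by rewrite subr_ge0.
move=> u v; rewrite !in_itv/= => /andP[u0 u1] /andP[v0 v1].
rewrite H ?in_itv/=; first by congr (`|_|); ring.
- by apply/andP; split; lra.
- by apply/andP; split; lra.
Qed.

Lemma geodesic_rev L gamma :
  is_geodesic L gamma -> is_geodesic L (fun u => gamma (L - u)).
Proof.
move=> [L0 H]; split=> // u v; rewrite !in_itv/= => /andP[u0 u1] /andP[v0 v1].
rewrite H ?in_itv/=; first by rewrite distrC; congr (`|_|); ring.
- by apply/andP; split; lra.
- by apply/andP; split; lra.
Qed.

Lemma geodesic_join L gamma s t : is_geodesic L gamma ->
  0 <= s -> s <= L -> 0 <= t -> t <= L ->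
  exists L' gamma', [/\ is_geodesic L' gamma', gamma' 0 = gamma s,
    gamma' L' = gamma t & forall u, 0 <= u -> u <= L' ->
      exists v, [/\ 0 <= v, v <= L & gamma' u = gamma v]].
Proof.
move=> H s0 sL t0 tL; case: (leP s t) => st.
  exists (t - s), (fun u => gamma (s + u)).
  split; [exact: geodesic_sub H _ _ _|by rewrite addr0|congr gamma; ring|].
  by move=> u u0 u1; exists (s + u); split=> //; lra.
exists (s - t), (fun u => gamma (t + (s - t - u))).
split; [|by congr gamma; ring|by congr gamma; ring|].
  by apply: (geodesic_rev (gamma := fun u => gamma (t + u)));
     apply: geodesic_sub H _ _ _ => //; exact: ltW.
by move=> u u0 u1; exists (t + (s - t - u)); split=> //; lra.
Qed.

Lemma nearest_self X x : X x -> nearest X x x.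
Proof. by move=> Xx; split=> // q _; rewrite mdistxx mdist_ge0. Qed.

Lemma set_edist1P X x (r : R) :
  (forall q, X q -> r <= mdist x q) -> (r%:E <= set_edist [set x] X)%E.
Proof.
move=> H; apply: le_ereal_inf_tmp => _ [_ -> [q Xq <-]].
by rewrite lee_fin; exact: H.
Qed.

Lemma nearest_projP X x p : nearest_proj X x p <-> nearest X x p.
Proof.
split=> [[Xp E]|[Xp H]]; split=> //.
  move=> q Xq; rewrite -lee_fin E; apply: ereal_inf_lbound.
  by exists x => //; exists q.
apply/eqP; rewrite eq_le; apply/andP; split; first exact: set_edist1P.
by apply: ereal_inf_lbound; exists x => //; exists p.
Qed.

Lemma contracting_diam C X L gamma s t p q : C_contracting C X ->
  is_geodesic L gamma ->
  (forall u x, 0 <= u -> u <= L -> X x -> C <= mdist (gamma u) x) ->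
  0 <= s -> s <= L -> 0 <= t -> t <= L ->
  nearest X (gamma s) p -> nearest X (gamma t) q -> mdist p q <= C.
Proof.
move=> HC Hg Hfar s0 sL t0 tL Hp Hq.
rewrite -lee_fin; apply: le_trans (HC L gamma Hg _).
  apply: ereal_sup_ubound; exists p; [|exists q => //].
    by exists (gamma s); [exists s => //; rewrite /= in_itv/= s0|exact/nearest_projP].
  by exists (gamma t); [exists t => //; rewrite /= in_itv/= t0|exact/nearest_projP].
apply: le_ereal_inf_tmp => _ [_ [u + <-] [x Xx <-]].
by rewrite /= in_itv/= => /andP[u0 uL]; rewrite lee_fin; exact: Hfar.
Qed.

(** Up to the first time at which the geodesic is [C]-close to [X], its
    projection stays in a set of diameter [C]. This time is an infimum that need
    not be attained, so [s] is taken one unit earlier; the last conclusion lets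
    the same lemma, applied to the reversed geodesic, give the exit in the right
    order. *)
Lemma contracting_entry C X L gamma p : 1 <= C -> C_contracting C X ->
  proximinal X -> is_geodesic L gamma -> nearest X (gamma 0) p ->
  (exists t, [/\ 0 <= t, t <= L & exists2 x, X x & mdist (gamma t) x < C]) ->
  exists s, [/\ 0 <= s, s <= L, mdist (gamma s) p <= 2 * C + 2 &
    forall t, 0 <= t -> t <= L -> (exists2 x, X x & mdist (gamma t) x < C) ->
    s <= t].
Proof.
move=> C1 HC HX Hg Hp Hne.
pose S := [set t | [/\ 0 <= t, t <= L & exists2 x, X x & mdist (gamma t) x < C]].
have Slb : lbound S 0 by move=> t [].
have Sinf : has_inf S by split; [case: Hne => t Ht; exists t|exists 0].
have [t St ts] := inf_adherent ltr01 Sinf.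
have inf0 : 0 <= inf S by apply: lb_le_inf => //; case: Sinf.
have infL u : S u -> inf S <= u.
  by move=> Su; apply: ge_inf Su; exists 0.
have itL := infL _ St.
case: (St) => t0 tL [x Xx tx].
case: (lerP (inf S) 1) => i1.
  exists 0; split=> //; first by apply: le_trans tL.
  have := geodesic_dist Hg (lexx 0) t0 tL.
  have := Hp.2 _ Xx; have := mdist_triangle (gamma t) (gamma 0) x; lra.
have is0 : 0 <= inf S - 1 by lra.
have isL : inf S - 1 <= L by lra.
have [r Hr] := HX (gamma (inf S - 1)).
exists (inf S - 1); split=> //; last first.
  by move=> u u0 uL Hu; have /infL : S u by []; lra.
have pr : mdist p r <= C.
  have Hg' := geodesic_sub Hg (lexx 0) is0 isL.
  rewrite subr0 in Hg'.
  apply: (contracting_diam (s := 0) (t := inf S - 1) HC Hg') => //.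
  - move=> u y u0 us Xy; rewrite leNgt; apply/negP => uy.
    have /infL : S u by split=> //; [lra|exists y => //; rewrite -[u in gamma u]add0r].
    by lra.
  - by rewrite addr0.
  - by rewrite add0r.
have := geodesic_dist Hg is0 (_ : inf S - 1 <= t) tL.
have := Hr.2 _ Xx; have := mdist_triangle (gamma t) (gamma (inf S - 1)) x.
have := mdist_triangle r (gamma (inf S - 1)) p; rewrite (mdist_sym r p).
move=> A1 A2 A3 /(_ _); rewrite (_ : (inf S - 1 <= t) = true); last by lra.
move=> /(_ isT); lra.
Qed.

Lemma contracting_gated C X : 1 <= C -> C_contracting C X -> proximinal X ->
  gated (2 * C + 2) X.
Proof.
move=> C1 HC HX L gamma Hg p q Hp Hq pq.
have L0 := geodesic_ge0 Hg.
have Hne : exists t,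
    [/\ 0 <= t, t <= L & exists2 x, X x & mdist (gamma t) x < C].
  apply: contrapT => Hne.
  have : mdist p q <= C.
    apply: (contracting_diam HC Hg _ (lexx 0) L0 L0 (lexx L) Hp Hq).
    move=> u x u0 uL Xx; rewrite leNgt; apply/negP => ux; apply: Hne.
    by exists u; split=> //; exists x.
  by lra.
have [s1 [s10 s1L s1p s1t]] := contracting_entry C1 HC HX Hg Hp Hne.
have [||s2 [s20 s2L s2p s2t]] := contracting_entry (p := q) C1 HC HX (geodesic_rev Hg).
- by rewrite subr0.
- case: Hne => t [t0 tL Ht]; exists (L - t); split; rewrite ?subKr//; lra.
exists s1, (L - s2); split=> //; last by lra.
case: Hne => t [t0 tL Ht]; have := s1t t t0 tL Ht.
have := s2t (L - t); rewrite subKr => /(_ _ _ Ht); lra.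
Qed.

Lemma gated_contracts C X : geodesic_space Y -> 0 <= C -> gated C X ->
  contracts (4 * C) X.
Proof.
move=> HY C0 HX x y p q Hp Hq.
have [L [gamma [Hg g0 gL]]] := HY x y.
case: (lerP (mdist p q) C) => pq; first by left; lra.
right; have := HX L gamma Hg p q; rewrite g0 gL => /(_ Hp Hq pq).
move=> [s1 [s2 [s10 s12 s2L A B]]].
have L0 := geodesic_ge0 Hg.
have := geodesic_dist Hg (lexx 0) L0 (lexx L); rewrite g0 gL => E.
have := geodesic_dist Hg (lexx 0) s10 (le_trans s12 s2L); rewrite g0 => E1.
have E2 := geodesic_dist Hg s10 s12 s2L.
have := geodesic_dist Hg (le_trans s10 s12) s2L (lexx L); rewrite gL => E3.
have := mdist_triangle (gamma s1) x p.
have := mdist_triangle (gamma s2) q y.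
have := mdist_triangle (gamma s1) p q.
have := mdist_triangle (gamma s2) (gamma s1) q.
rewrite (mdist_sym p (gamma s1)) (mdist_sym q (gamma s2)); lra.
Qed.

Lemma contracts_le C C' X : C <= C' -> contracts C X -> contracts C' X.
Proof.
move=> CC' H x y p q Hp Hq; case: (H _ _ _ _ Hp Hq) => A; [left|right]; lra.
Qed.

Lemma gated_le C C' X : C <= C' -> gated C X -> gated C' X.
Proof.
move=> CC' H L gamma Hg p q Hp Hq pq.
have [|s1 [s2 [A B D E F]]] := H L gamma Hg p q Hp Hq; first by lra.
by exists s1, s2; split=> //; lra.
Qed.

Lemma contractsP C X x y p q : contracts C X ->
  nearest X x p -> nearest X y q ->
  mdist p q <= C \/ mdist x p + mdist p q + mdist q y <= mdist x y + C.
Proof. by move=> HC; exact: HC. Qed.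

Lemma contracts_lip C X x y p q : contracts C X -> 0 <= C ->
  nearest X x p -> nearest X y q -> mdist p q <= mdist x y + C.
Proof.
move=> HC C0 Hp Hq; have := mdist_ge0 x p; have := mdist_ge0 q y.
have := mdist_ge0 x y; case: (contractsP HC Hp Hq); lra.
Qed.

(** If [z] projects far from both ends, then the detours of [contracts] for the
    two halves add up, and comparison with the direct way from [x] to [y] places
    [r] between [p] and [q]. *)
Lemma contracts_aligned C X x y z p q r : contracts C X -> 0 <= C ->
  nearest X x p -> nearest X y q -> nearest X z r ->
  mdist x z + mdist z y <= mdist x y -> mdist p r <= mdist p q + 2 * C.
Proof.
move=> HC C0 Hp Hq Hr xzy.
have := mdist_triangle q p r; have := mdist_triangle p x y.
have := mdist_triangle q p y.
have := mdist_ge0 r q; have := mdist_ge0 z r.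
have := mdist_sym q r; have := mdist_sym r z; have := mdist_ge0 p q.
have := mdist_sym y q; have := mdist_sym x p.
case: (contractsP HC Hp Hr); first by lra.
case: (contractsP HC Hr Hq); lra.
Qed.

(** Same computation as for [contracts_aligned]: a point [z] far from [X] would
    make the two detours longer than the way from [x] to [y] along [X]. *)
Lemma contracts_quasiconvex C X r x y z x' y' q : contracts C X -> 0 <= C ->
  proximinal X -> 0 <= r ->
  X x' -> X y' -> mdist x x' <= r -> mdist y y' <= r ->
  nearest X z q -> mdist x z + mdist z y <= mdist x y ->
  mdist z q <= 2 * r + 2 * C.
Proof.
move=> HC C0 HX r0 Xx' Xy' xx' yy' Hq xzy.
have [p Hp] := HX x; have [s Hs] := HX y.
have xp := Hp.2 _ Xx'; have ys := Hs.2 _ Xy'.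
have := mdist_triangle p x y; have := mdist_triangle s p y.
have := mdist_triangle q p s.
have := mdist_triangle x z q; have := mdist_triangle y z q.
have := mdist_triangle p x q; have := mdist_triangle s y q.
have := mdist_sym s y; have := mdist_sym y z; have := mdist_sym z x.
have := mdist_sym q z; have := mdist_sym s q; have := mdist_sym p x.
have := mdist_sym s p; have := mdist_sym q p.
have := mdist_ge0 q s; have := mdist_ge0 p q; have := mdist_ge0 x p; have := mdist_ge0 y s.
have := mdist_ge0 x z; have := mdist_ge0 z y; have := mdist_ge0 z q.
case: (contractsP HC Hp Hq); case: (contractsP HC Hq Hs); lra.
Qed.

(** If both alternatives failed, the way from [x] to [q] would pass through [p]
    and the way from [x] to [p] through [q], with a loss at each. *)
Lemma behrstock C X1 X2 x p q p' q' : contracts C X1 -> contracts C X2 ->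
  nearest X1 x p -> nearest X2 x q -> nearest X1 q p' -> nearest X2 p q' ->
  mdist p p' <= C \/ mdist q q' <= C.
Proof.
move=> H1 H2 Hp Hq Hp' Hq'.
case: (lerP (mdist p p') C) => A; first by left.
case: (lerP (mdist q q') C) => B; first by right.
have := mdist_ge0 p' q; have := mdist_ge0 q' p.
case: (H1 _ _ _ _ Hp Hp'); first by lra.
case: (H2 _ _ _ _ Hq Hq'); lra.
Qed.

End NearestPoints.

(** * Translates of an axis and words of barrier-free letters *)

Section Translates.
Context {R : realType} {G : groupType} {Y : metricType R}.
Variables (a : isometric_action G Y) (o : Y).
Implicit Types (X U V : set Y) (x y z p q : Y) (C K : R) (f g t : G).

Lemma actK g x : a g^-1%g (a g x) = x.
Proof. by rewrite -actM mulVg act1. Qed.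

Lemma actVK g x : a g (a g^-1%g x) = x.
Proof. by rewrite -actM mulgV act1. Qed.

Lemma act_distl g x y : mdist (a g x) y = mdist x (a g^-1%g y).
Proof. by rewrite -(act_isometry a g x) actVK. Qed.

Lemma act_distr g x y : mdist x (a g y) = mdist (a g^-1%g x) y.
Proof. by rewrite -(act_isometry a g^-1%g x) actK. Qed.

Definition translate t X : set Y := [set y | X (a t^-1%g y)].

Definition stabilizes f X := translate f X = X.

Lemma translate1 X : translate 1%g X = X.
Proof. by apply/funext => y; rewrite /translate /= invg1 act1. Qed.

Lemma translateM s t X : translate (s * t)%g X = translate s (translate t X).
Proof. by apply/funext => y; rewrite /translate /= invgM actM. Qed.

Lemma translate_act g t X x :
  translate (g * t)%g X (a g x) <-> translate t X x.
Proof. by rewrite translateM {1}/translate /= actK. Qed.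

Lemma translate_mem t X x : translate t X (a t x) <-> X x.
Proof. by rewrite /translate /= actK. Qed.

Lemma stabilizesV f X : stabilizes f X -> stabilizes f^-1%g X.
Proof.
by move=> fX; rewrite /stabilizes -{1}fX -translateM mulVg translate1.
Qed.

Lemma nearest_translate t X x p :
  nearest (translate t X) x p <-> nearest X (a t^-1%g x) (a t^-1%g p).
Proof.
split=> -[Xp H]; split=> // q Xq; rewrite ?act_isometry.
  by rewrite act_distl invgK; apply: H; apply/translate_mem.
by have := H _ Xq; rewrite !act_isometry.
Qed.

Lemma nearest_act g t X x p : nearest (translate t X) x p <->
  nearest (translate (g * t)%g X) (a g x) (a g p).
Proof.
by rewrite !nearest_translate invgM !actM !actK.
Qed.

Lemma proximinal_translate t X : proximinal X -> proximinal (translate t X).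
Proof.
move=> HX x; have [p Hp] := HX (a t^-1%g x).
by exists (a t p); apply/nearest_translate; rewrite actK.
Qed.

Lemma contracts_translate t C X : contracts C X -> contracts C (translate t X).
Proof.
move=> HX x y p q /nearest_translate Hp /nearest_translate Hq.
by have := HX _ _ _ _ Hp Hq; rewrite !act_isometry.
Qed.

Lemma gated_translate t C X : gated C X -> gated C (translate t X).
Proof.
move=> HX L gamma [L0 Hg] p q /nearest_translate Hp /nearest_translate Hq.
have Hg' : is_geodesic L (a t^-1%g \o gamma).
  by split=> // u v uL vL; rewrite /= act_isometry; exact: Hg.
rewrite -(act_isometry a t^-1%g) => pq.
have [s1 [s2 [A B D E F]]] := HX L _ Hg' _ _ Hp Hq pq.
by exists s1, s2; split=> //; [move: E|move: F]; rewrite /= act_isometry.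
Qed.

Definition bounded_proj C U V := forall x y p q, V x -> V y ->
  nearest U x p -> nearest U y q -> mdist p q <= C.

(** The facts about the axis [X] of a contracting element on which the rest of
    the argument relies. The elements of [E] move [X] to a parallel set, the
    others to a set of bounded projection; [axis_line] says that [X] is a coarse
    line, on which progress over the middle part of four points is not undone by
    the outer parts. *)
Record barrier_axis X (E : set G) C : Prop := BarrierAxis {
  axis_ge1 : 1 <= C;
  axis_base : X o;
  axis_proximinal : proximinal X;
  axis_gated : gated C X;
  axis_contracts : contracts C X;
  axis_orbit : forall z, X z -> exists2 f, stabilizes f X & z = a f o;
  axis_bounded : forall g, ~ E g -> bounded_proj C X (translate g X);
  axis_inv : forall g, E g -> E g^-1%g;
  axis_conj : forall f g, stabilizes f X -> E g -> E (f^-1 * g * f)%g;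
  axis_close : forall g x, E g -> X x ->
    exists2 y, translate g X y & mdist x y <= C;
  axis_line : forall e q z1 z2 p, 0 <= e -> X q -> X z1 -> X z2 -> X p ->
    mdist q z1 + mdist z1 z2 <= mdist q z2 + e ->
    mdist z1 z2 + mdist z2 p <= mdist z1 p + e ->
    mdist z1 z2 <= mdist q p + 2 * e + C;
  axis_unbounded : forall r : R, exists2 f, stabilizes f X & r < mdist o (a f o)
}.

(** Nearest points are not unique, hence the condition on all choices. *)
Definition barrier_free X K g := forall t p q,
  nearest (translate t X) o p -> nearest (translate t X) (a g o) q ->
  mdist p q <= K.

(** If [z] projects to [V] far from where [U] does, then [V] separates [z] from
    [U], so that [z] projects to [U] where [V] does. *)
Lemma chain_step C U V z p v r : contracts C U -> contracts C V ->
  proximinal U -> proximinal V -> bounded_proj C U V ->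
  nearest U z p -> V v -> nearest U v r ->
  (forall p' u u', nearest V z p' -> U u -> nearest V u u' -> C < mdist p' u') ->
  mdist p r <= 2 * C.
Proof.
move=> HU HV PU PV B Hp Vv Hr far.
have [p' Hp'] := PV z; have [p1 Hp1] := PU p'; have [u' Hu'] := PV p.
have := far _ _ _ Hp' Hp.1 Hu'.
have := B _ _ _ _ Hp'.1 Vv Hp1 Hr.
have := mdist_triangle p1 p r.
case: (behrstock HU HV Hp Hp' Hp1 Hu'); lra.
Qed.

Section Axis.
Variables (X : set Y) (E : set G) (C : R).
Hypothesis AX : barrier_axis X E C.

Lemma axis_translate_prox t : proximinal (translate t X).
Proof. exact: proximinal_translate (axis_proximinal AX). Qed.

Lemma axis_translate_contracts t : contracts C (translate t X).
Proof. exact: contracts_translate (axis_contracts AX). Qed.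

Lemma axis_translate_bounded s t : ~ E (s^-1 * t)%g ->
  bounded_proj C (translate s X) (translate t X).
Proof.
move=> nE x y p q tx ty /nearest_translate Hp /nearest_translate Hq.
rewrite -(act_isometry a s^-1%g).
by apply: (axis_bounded AX nE) Hp Hq; apply/translate_act.
Qed.

Lemma axis_translate_boundedV s t : ~ E (s^-1 * t)%g ->
  bounded_proj C (translate t X) (translate s X).
Proof.
move=> nE; apply: axis_translate_bounded => Ets; apply: nE.
by have := axis_inv AX Ets; rewrite invgM invgK.
Qed.

Lemma translate_base t : translate t X (a t o).
Proof. by apply/translate_mem; exact: axis_base AX. Qed.

(** A barrier-free element leaves no trace on the two translates of [X] through
    its endpoints; this makes it a letter that can be followed and preceded by a
    power along the axis. *)
Lemma barrier_free_start K g q : barrier_free X K g ->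
  nearest X (a g o) q -> mdist o q <= K.
Proof.
move=> Bg Hq; apply: (Bg 1%g); rewrite translate1 //.
exact/nearest_self/(axis_base AX).
Qed.

Lemma barrier_free_end K g p : barrier_free X K g ->
  nearest (translate g X) o p -> mdist p (a g o) <= K.
Proof.
by move=> Bg Hp; apply: (Bg g) => //; exact/nearest_self/translate_base.
Qed.

(** Every letter is followed by the connecting element [f]. *)
Fixpoint word f (w : seq G) : G :=
  if w is b :: w' then (b * f * word f w')%g else 1%g.

Lemma nearest_stab f x p : stabilizes f X ->
  nearest X (a f x) p <-> nearest X x (a f^-1%g p).
Proof.
by move=> fX; rewrite -{1}fX nearest_translate actK.
Qed.

Section Words.
Variables (K : R) (f : G).
Hypotheses (K0 : 0 <= K) (fX : stabilizes f X)
  (fbig : 10 * C + 10 * K < mdist o (a f o)).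

(** The translate through the first letter separates the endpoint of the word
    from [X]: from [o] this translate is seen near [b o], and from the endpoint,
    by induction, near [b f o]. *)
Lemma word_proj_start w p : (forall b, b \in w -> barrier_free X K b /\ ~ E b) ->
  nearest X (a (word f w) o) p -> mdist p o <= 2 * C + K.
Proof.
have C1 := axis_ge1 AX; have Kp := K0; have fb := fbig.
elim: w p => [p _ /=|b w IH p Hw Hp].
  by rewrite act1 => -[_ /(_ _ (axis_base AX))]; rewrite mdistxx mdist_sym; lra.
have [Bb nEb] := Hw b (mem_head _ _).
have [r Hr] := axis_proximinal AX (a b o).
have := barrier_free_start Bb Hr; have := mdist_triangle r p o.
suff : mdist p r <= 2 * C by rewrite (mdist_sym r o); lra.
have nE' : ~ E (1^-1 * b)%g by rewrite invg1 mul1g.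
have bd := axis_translate_bounded nE'; have bdV := axis_translate_boundedV nE'.
rewrite translate1 in bd bdV.
apply: (chain_step (axis_contracts AX) (@axis_translate_contracts b)
  (axis_proximinal AX) (axis_translate_prox b) bd Hp (translate_base b) Hr).
move=> p' u u' /nearest_translate; rewrite /= !actM actK => Hp' Xu Hu'.
have [r0 Hr0] := axis_translate_prox b o.
have A1 := bdV _ _ _ _ Xu (axis_base AX) Hu' Hr0.
have A2 := barrier_free_end Bb Hr0.
move/(nearest_stab _ _ fX): Hp' => /IH.
move=> /(_ (fun c cw => Hw c (mem_behead (s := b :: w) cw))).
rewrite act_distl invgK act_distl invgK => A3.
have A4 := act_isometry a b o (a f o).
have := mdist_triangle u' (a b o) (a b (a f o)).
have := mdist_triangle p' u' (a b (a f o)).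
have := mdist_triangle r0 u' (a b o).
rewrite (mdist_sym (a b o) u') (mdist_sym u' p'); lra.
Qed.

Lemma word_proj_first b w p :
  (forall c, c \in b :: w -> barrier_free X K c /\ ~ E c) ->
  nearest (translate b X) (a (word f (b :: w)) o) p ->
  mdist p (a b (a f o)) <= 2 * C + K.
Proof.
move=> Hw /nearest_translate; rewrite /= !actM actK => /(nearest_stab _ _ fX) Hp.
have := word_proj_start (fun c cw => Hw c (mem_behead (s := b :: w) cw)) Hp.
by rewrite act_distl invgK act_distl invgK.
Qed.

(** The hypothesis on [s] says that [o] is not separated from the axis of [b'] by
    that of [b]. The common endpoint projects to the axis of [b] near [b f o], far
    from [r]; by the Behrstock inequality it projects to the axis of [b'] as the
    axis of [b] does, and then [b] would contain the barrier that follows [b']. *)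
Lemma word_first_aux b b' w w' r r' :
  (forall c, c \in b :: w -> barrier_free X K c /\ ~ E c) ->
  (forall c, c \in b' :: w' -> barrier_free X K c /\ ~ E c) ->
  word f (b :: w) = word f (b' :: w') -> ~ E (b^-1 * b')%g ->
  nearest (translate b X) o r -> nearest (translate b' X) o r' ->
  (exists2 s, nearest (translate b X) r' s & mdist r s <= C) -> False.
Proof.
have C1 := axis_ge1 AX; have Kp := K0; have fb := fbig.
move=> Hw Hw' ww' nE Hr Hr' [s Hs rs].
have [Bb _] := Hw b (mem_head _ _); have [Bb' _] := Hw' b' (mem_head _ _).
have bd := axis_translate_bounded nE; have bdV := axis_translate_boundedV nE.
set z := a (word f (b :: w)) o.
have [p Hp] := axis_translate_prox b z.
have [p' Hp'] := axis_translate_prox b' z.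
have A1 := word_proj_first Hw Hp.
have A2 : mdist p' (a b' (a f o)) <= 2 * C + K.
  by apply: word_proj_first Hw' _; rewrite -ww'.
have [q Hq] := axis_translate_prox b p'.
have [q' Hq'] := axis_translate_prox b' p.
have A3 := barrier_free_end Bb Hr.
have A4 := barrier_free_end Bb' Hr'.
have A5 := bd _ _ _ _ Hr'.1 Hp'.1 Hs Hq.
have E1 := act_isometry a b o (a f o).
have E2 := act_isometry a b' o (a f o).
case: (behrstock (@axis_translate_contracts b) (@axis_translate_contracts b')
  Hp Hp' Hq Hq') => A6.
  have := mdist_triangle r (a b o) (a b (a f o)).
  have := mdist_triangle s r (a b (a f o)).
  have := mdist_triangle q s (a b (a f o)).
  have := mdist_triangle p q (a b (a f o)).
  rewrite (mdist_sym (a b o) r) (mdist_sym q p); lra.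
have [v Hv] := axis_translate_prox b' (a b o).
have A7 := Bb b' _ _ Hr' Hv.
have A8 := bdV _ _ _ _ Hp.1 (translate_base b) Hq' Hv.
have := mdist_triangle r' (a b' o) (a b' (a f o)).
have := mdist_triangle v r' (a b' (a f o)).
have := mdist_triangle q' v (a b' (a f o)).
have := mdist_triangle p' q' (a b' (a f o)).
rewrite (mdist_sym (a b' o) r') (mdist_sym v q') (mdist_sym q' p'); lra.
Qed.

(** Two transverse axes would be ordered as seen from [o], which is impossible in
    either order; so the axes are parallel, and both first letters end near the
    projections of [o]. *)
Lemma word_first_close b b' w w' :
  (forall c, c \in b :: w -> barrier_free X K c /\ ~ E c) ->
  (forall c, c \in b' :: w' -> barrier_free X K c /\ ~ E c) ->
  word f (b :: w) = word f (b' :: w') ->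
  mdist (a b o) (a b' o) <= 2 * K + 5 * C.
Proof.
have C1 := axis_ge1 AX; have Kp := K0.
move=> Hw Hw' ww'.
have [Bb _] := Hw b (mem_head _ _); have [Bb' _] := Hw' b' (mem_head _ _).
have [r Hr] := axis_translate_prox b o.
have [r' Hr'] := axis_translate_prox b' o.
case: (pselect (E (b^-1 * b')%g)) => Ebb'; last first.
  exfalso; have [s Hs] := axis_translate_prox b r'.
  have [s' Hs'] := axis_translate_prox b' r.
  case: (behrstock (@axis_translate_contracts b) (@axis_translate_contracts b')
    Hr Hr' Hs Hs') => A.
    by apply: (word_first_aux Hw Hw' ww' Ebb' Hr Hr'); exists s.
  apply: (word_first_aux Hw' Hw (esym ww') _ Hr' Hr); last by exists s'.
  by move=> E'; apply: Ebb'; have := axis_inv AX E'; rewrite invgM invgK.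
have A3 := barrier_free_end Bb Hr.
have A4 := barrier_free_end Bb' Hr'.
have close c c' x : E (c^-1 * c')%g -> translate c X x ->
    exists2 y, translate c' X y & mdist x y <= C.
  move=> Ec cx; have [y Hy xy] := axis_close AX Ec cx.
  exists (a c y); last by rewrite act_distr.
  by rewrite -(mulVKg c c'); apply/translate_act.
have [y Hy ry] := close _ _ _ Ebb' Hr.1.
have [|y' Hy' ry'] := close b' b r' _ Hr'.1.
  by have := axis_inv AX Ebb'; rewrite invgM invgK.
have := Hr'.2 _ Hy.
have := mdist_triangle r o y; have := mdist_triangle r' o y'.
have := mdist_triangle y' r r'; have := mdist_triangle r (a b o) (a b' o).
have := mdist_triangle r' r (a b' o); have := mdist_ge0 o r.
rewrite (mdist_sym y' r') (mdist_sym (a b o) r) .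
have [] := contractsP (@axis_translate_contracts b) Hr (nearest_self Hy').
  by lra.
rewrite mdistxx; lra.
Qed.

End Words.

(** Projections to a fixed translate vary almost monotonically along a geodesic,
    so a subsegment sees barriers that are at most slightly deeper. *)
Lemma barrier_free_sub K M L gamma g s s' u v : 0 <= M ->
  barrier_free X K g -> is_geodesic L gamma -> gamma 0 = o -> gamma L = a g o ->
  0 <= s -> s <= s' -> s' <= L ->
  mdist (gamma s) (a u o) <= M -> mdist (gamma s') (a v o) <= M ->
  barrier_free X (K + 2 * M + 6 * C) (u^-1 * v)%g.
Proof.
have C1 := axis_ge1 AX.
move=> M0 Bg Hg g0 gL s0 ss' s'L us vs t p q Hp Hq.
have C0 : 0 <= C by lra.
pose T := translate (u * t)%g X.
have HT : contracts C T := @axis_translate_contracts _.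
have PT : proximinal T := @axis_translate_prox _.
have Hp' : nearest T (a u o) (a u p) := (@nearest_act u t X o p).1 Hp.
have Hq' : nearest T (a v o) (a u q).
  by have := (@nearest_act u t X _ q).1 Hq; rewrite -actM mulVKg.
rewrite -(act_isometry a u).
have [p0 Hp0] := PT o; have [q0 Hq0] := PT (a g o).
have [ps Hps] := PT (gamma s); have [qs Hqs] := PT (gamma s').
have A1 := Bg _ _ _ Hp0 Hq0.
have L0 := geodesic_ge0 Hg.
have s'0 := le_trans s0 ss'.
have D1 := geodesic_dist Hg (lexx 0) s'0 s'L; rewrite g0 in D1.
have D2 := geodesic_dist Hg s'0 s'L (lexx L); rewrite gL in D2.
have D3 := geodesic_dist Hg (lexx 0) L0 (lexx L); rewrite g0 gL in D3.
have D4 := geodesic_dist Hg (lexx 0) s0 (le_trans ss' s'L); rewrite g0 in D4.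
have D5 := geodesic_dist Hg s0 ss' s'L.
have A2 : mdist p0 qs <= mdist p0 q0 + 2 * C.
  by apply: (contracts_aligned HT C0 Hp0 Hq0 Hqs); lra.
have A3 : mdist qs ps <= mdist qs p0 + 2 * C.
  apply: (contracts_aligned HT C0 Hqs Hp0 Hps).
  have := mdist_sym o (gamma s); have := mdist_sym o (gamma s').
  have := mdist_sym (gamma s) (gamma s'); lra.
have A4 := contracts_lip HT C0 Hps Hp'.
have A5 := contracts_lip HT C0 Hqs Hq'.
have := mdist_triangle ps (a u p) (a u q).
have := mdist_triangle qs ps (a u q).
have := mdist_sym qs ps; have := mdist_sym p0 qs.
have := mdist_sym ps (a u p); lra.
Qed.

End Axis.
End Translates.

(** * Integer powers *)

Section IntegerPowers.
Context {G : groupType}.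
Implicit Types (g h : G).

Lemma zexpgS g (n : int) : zexpg g (1 + n) = (g * zexpg g n)%g.
Proof.
case: n => [k|[|k]] /=; first by rewrite -expgS.
  by rewrite expg1 mulgV.
by rewrite subn1 [(g ^+ k.+2)%g]expgSr invgM mulVKg.
Qed.

Lemma zexpgD g (m n : int) : zexpg g (m + n) = (zexpg g m * zexpg g n)%g.
Proof.
have P k l : zexpg g (k%:Z + l) = (zexpg g k%:Z * zexpg g l)%g.
  elim: k => [|k IH]; first by rewrite add0r mul1g.
  by rewrite intS -addrA !zexpgS IH mulgA.
case: m => [k|k]; first exact: P.
apply: (mulgI (zexpg g k.+1%:Z)); rewrite -P NegzE mulgA addrA subrr add0r.
by rewrite /= mulgV mul1g.
Qed.

Lemma zexpgN g (n : int) : zexpg g (- n) = (zexpg g n)^-1%g.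
Proof. by apply: (mulgI (zexpg g n)); rewrite -zexpgD subrr mulgV. Qed.

Lemma zexpgM g (m n : int) : zexpg g (m * n) = zexpg (zexpg g m) n.
Proof.
have P k : zexpg g (m * k%:Z) = zexpg (zexpg g m) k%:Z.
  elim: k => [|k IH]; first by rewrite mulr0.
  by rewrite intS mulrDr mulr1 zexpgS zexpgD IH.
by case: n => [k|k]; [exact: P|rewrite NegzE mulrN !zexpgN P].
Qed.

Lemma zexpg_conj g x (n : int) :
  zexpg (x * g * x^-1)%g n = (x * zexpg g n * x^-1)%g.
Proof.
have P k : zexpg (x * g * x^-1)%g k%:Z = (x * zexpg g k%:Z * x^-1)%g.
  elim: k => [|k IH]; first by rewrite /= mulg1 mulgV.
  by rewrite intS !zexpgS IH !mulgA mulgVK.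
by case: n => [k|k]; [exact: P|rewrite NegzE !zexpgN P !invgM invgK mulgA].
Qed.

End IntegerPowers.

(** * A chain of translates makes an element contracting *)

Section Chain.
Context {R : realType} {G : groupType} {Y : metricType R}.
Variables (a : isometric_action G Y) (o : Y).
Variables (X : set Y) (E : set G) (C : R).
Hypothesis AX : barrier_axis a o X E C.
Implicit Types (x y z p q : Y) (f g t : G).

(** The translates [t X] and [g t X] are transverse, and the two neighbours of
    [t X] in the chain of translates by powers of [g] project to it near points
    [p0] and [q0] that are far apart. *)
Record chain_at g t p0 q0 : Prop := ChainAt {
  chain_nE : ~ E (t^-1 * (g * t))%g;
  chain_fwd : exists2 y, translate a (g * t)%g X y &
                         nearest (translate a t X) y p0;
  chain_bwd : exists2 y, translate a (g^-1 * t)%g X y &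
                         nearest (translate a t X) y q0;
  chain_far : 10 * C < mdist p0 q0
}.

Lemma chain_atV g t p0 q0 : chain_at g t p0 q0 -> chain_at g^-1%g t q0 p0.
Proof.
case=> nE H1 H2 H3; split; rewrite ?invgK ?(mdist_sym q0)// => E'; apply: nE.
by have := axis_inv AX E'; rewrite !invgM !invgK mulgA.
Qed.

Lemma chain_at_conj f g t p0 q0 : chain_at g t p0 q0 ->
  chain_at (f * g * f^-1)%g (f * t)%g (a f p0) (a f q0).
Proof.
case=> nE [y Hy Hp] [z Hz Hq] H3; split.
- by rewrite invgM -!mulgA mulKg mulKg.
- exists (a f y); last exact: (@nearest_act _ _ _ a f t X y p0).1.
  by rewrite -!mulgA mulKg; apply/translate_act.
- exists (a f z); last exact: (@nearest_act _ _ _ a f t X z q0).1.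
  by rewrite !invgM invgK -!mulgA mulKg; apply/translate_act.
- by rewrite act_isometry.
Qed.

Lemma translate_nearest_back g t x p :
  nearest (translate a (g * t)%g X) x p ->
  nearest (translate a t X) (a g^-1%g x) (a g^-1%g p).
Proof.
by move=> H; apply: (@nearest_act _ _ _ a g t X _ _).2; rewrite !actVK.
Qed.

(** Each translate of the chain separates the previous one from the next, hence
    by induction from all later ones. *)
Lemma chain_proj g t p0 q0 n x p : chain_at g t p0 q0 ->
  translate a (g ^+ n.+1 * t)%g X x -> nearest (translate a t X) x p ->
  mdist p p0 <= 2 * C.
Proof.
move=> H; have C1 := axis_ge1 AX.
case: (H) => nE [y0 Hy0 Hp0] [w0 Hw0 Hq0] far.
have bd := axis_translate_bounded AX nE.
have bd' : bounded_proj C (translate a t X) (translate a (g^-1 * t)%g X).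
  by apply: (axis_translate_bounded AX); case: (chain_atV H).
elim: n x p => [|n IH] x p Hx Hp.
  have := bd _ _ _ _ _ Hy0 Hp Hp0; rewrite -[g in (g * t)%g](expg1 g) => /(_ Hx).
  lra.
apply: (chain_step (@axis_translate_contracts _ _ _ _ _ _ _ _ AX t)
  (@axis_translate_contracts _ _ _ _ _ _ _ _ AX (g * t)%g)
  (axis_translate_prox AX t) (axis_translate_prox AX (g * t)%g) bd Hp Hy0 Hp0).
move=> p' u u' /translate_nearest_back Hp' Hu /translate_nearest_back Hu'.
have A1 : mdist (a g^-1%g p') p0 <= 2 * C.
  apply: IH Hp'; apply/(translate_act a g).
  by rewrite actVK mulgA -expgS.
have A2 : mdist (a g^-1%g u') q0 <= C.
  by apply: (bd' _ _ _ _ _ Hw0 Hu' Hq0); apply/translate_act.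
rewrite -(act_isometry a g^-1%g).
have := mdist_triangle (a g^-1%g p') p0 q0.
have := mdist_triangle (a g^-1%g u') (a g^-1%g p') q0.
rewrite (mdist_sym p0 (a _ _)); lra.
Qed.

(** Crossing an intermediate translate costs at least its barrier, which is
    longer than 1. *)
Lemma chain_separation g t p0 q0 n x y : chain_at g t p0 q0 ->
  translate a t X x -> translate a (g ^+ n.+1 * t)%g X y ->
  n%:R <= mdist x y.
Proof.
move=> H; have C1 := axis_ge1 AX; have Hfar := chain_far H.
elim: n x y => [|n IH] x y Hx Hy; first exact: mdist_ge0.
have [p Hp] := axis_translate_prox AX (g * t)%g x.
have [q Hq] := axis_translate_prox AX (g * t)%g y.
have HC := @axis_translate_contracts _ _ _ _ _ _ _ _ AX (g * t)%g.
have Hp' := translate_nearest_back Hp; have Hq' := translate_nearest_back Hq.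
have back z m : translate a (g ^+ m.+1 * t)%g X z ->
    translate a (g ^+ m * t)%g X (a g^-1%g z).
  by move=> Hz; apply/(translate_act a g); rewrite actVK mulgA -expgS.
have A1 : mdist (a g^-1%g q) p0 <= 2 * C by apply: (chain_proj H (back _ _ Hy)).
have A2 : mdist (a g^-1%g p) q0 <= 2 * C.
  apply: (chain_proj (n := 0) (chain_atV H) _ Hp').
  by rewrite expg1; apply/translate_act.
have A3 : n%:R <= mdist (a g^-1%g q) (a g^-1%g y) by apply: IH (back _ _ Hy); exact: Hq'.1.
rewrite act_isometry in A3.
have := mdist_triangle (a g^-1%g q) p0 q0.
have := mdist_triangle (a g^-1%g p) (a g^-1%g q) q0.
rewrite (act_isometry a g^-1%g q p) (mdist_sym p0 (a _ _)) (mdist_sym q p).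
have := mdist_ge0 x p; rewrite -natr1.
case: (contractsP HC Hp Hq); lra.
Qed.

Lemma chain_orbit_separation g t p0 q0 n x : chain_at g t p0 q0 ->
  translate a t X x ->
  n%:R - mdist o (a t o) <= mdist x (a (g ^+ n.+1)%g o).
Proof.
move=> H Hx; have Hy : translate a (g ^+ n.+1 * t)%g X (a (g ^+ n.+1)%g (a t o)).
  by rewrite -actM; apply/translate_mem; exact: axis_base AX.
have := chain_separation H Hx Hy.
have := mdist_triangle (a (g ^+ n.+1)%g o) x (a (g ^+ n.+1)%g (a t o)).
rewrite act_isometry; lra.
Qed.

Lemma chain_orbit_proj g t p0 q0 n p : chain_at g t p0 q0 ->
  2 * mdist o (a t o) + C < n%:R ->
  nearest (translate a t X) (a (g ^+ n.+1)%g o) p -> mdist p p0 <= 3 * C.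
Proof.
move=> H nbig Hp; have C1 := axis_ge1 AX.
have Hy : translate a (g ^+ n.+1 * t)%g X (a (g ^+ n.+1)%g (a t o)).
  by rewrite -actM; apply/translate_mem; exact: axis_base AX.
have [q Hq] := axis_translate_prox AX t (a (g ^+ n.+1)%g (a t o)).
have A1 := chain_proj H Hy Hq.
have A2 := chain_orbit_separation n H Hp.1.
have HC := @axis_translate_contracts _ _ _ _ _ _ _ _ AX t.
have := mdist_triangle q p p0.
have := mdist_sym p (a (g ^+ n.+1)%g o).
have := act_isometry a (g ^+ n.+1)%g o (a t o).
have := mdist_ge0 p q; have := mdist_ge0 q (a (g ^+ n.+1)%g (a t o)).
case: (contractsP HC Hp Hq); lra.
Qed.

(** If [x] is closer to an orbit point far ahead than to [o], it lies ahead of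
    [t X] too: otherwise the way from [x] to that point would pass near [p0], and
    thus near [o]. *)
Lemma chain_near_proj g t p0 q0 n x p : chain_at g t p0 q0 ->
  2 * mdist o (a t o) + 4 * C + mdist p0 o < n%:R ->
  mdist x (a (g ^+ n.+1)%g o) <= mdist x o ->
  nearest (translate a t X) x p -> mdist p p0 <= 4 * C.
Proof.
move=> H nbig xo Hp; have C1 := axis_ge1 AX.
have [q Hq] := axis_translate_prox AX t (a (g ^+ n.+1)%g o).
have := mdist_ge0 o (a t o); have := mdist_ge0 p0 o => P1 P2.
have A1 : mdist q p0 <= 3 * C by apply: (chain_orbit_proj H _ Hq); lra.
have A2 := chain_orbit_separation n H Hq.1.
have HC := @axis_translate_contracts _ _ _ _ _ _ _ _ AX t.
have := mdist_triangle q p p0; have := mdist_triangle p x o.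
have := mdist_triangle q p o; have := mdist_triangle p0 q o.
case: (contractsP HC Hp Hq); lra.
Qed.

Lemma orbit_upper g (n : nat) : mdist o (a (g ^+ n)%g o) <= n%:R * mdist o (a g o).
Proof.
elim: n => [|n IH]; first by rewrite /= act1 mdistxx mul0r.
rewrite expgSr actM -natr1 mulrDl mul1r.
have := mdist_triangle (a (g ^+ n)%g o) o (a (g ^+ n)%g (a g o)).
rewrite act_isometry; lra.
Qed.

Lemma zorbit_dist g (i : int) (n : nat) :
  mdist (a (zexpg g i) o) (a (zexpg g (i + n%:Z)) o) = mdist o (a (g ^+ n)%g o).
Proof. by rewrite zexpgD actM act_isometry. Qed.

Lemma int_leP (P : int -> int -> Prop) : (forall i j, P i j -> P j i) ->
  (forall i (n : nat), P i (i + n%:Z)) -> forall i j, P i j.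
Proof.
move=> Psym Pn i j; case: (lerP i j) => ij.
  by have -> : j = i + `|j - i|%N%:Z by lia.
by apply: Psym; have -> : i = j + `|i - j|%N%:Z by lia.
Qed.

Lemma chain_qi g t p0 q0 : chain_at g t p0 q0 ->
  quasi_isometric_embedding (fun n : int => a (zexpg g n) o).
Proof.
move=> H; exists (1 + mdist o (a g o)), (1 + 2 * mdist o (a t o)).
have P1 := mdist_ge0 o (a g o); have P2 := mdist_ge0 o (a t o).
split; [lra|lra|].
apply: (int_leP (P := fun i j => (1 + mdist o (a g o))^-1 * `|i - j|%:~R -
  (1 + 2 * mdist o (a t o)) <= mdist (a (zexpg g i) o) (a (zexpg g j) o)
  <= (1 + mdist o (a g o)) * `|i - j|%:~R + (1 + 2 * mdist o (a t o))))
  => [i j|i n]; first by rewrite (distrC i j) (mdist_sym (a (zexpg g i) o)).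
have -> : `|i - (i + n%:Z)| = n%:Z by rewrite opprD addrA subrr add0r normrN.
rewrite -pmulrn zorbit_dist; apply/andP; split; last first.
  by have := orbit_upper g n; have : 0 <= n%:R :> R by []; lra.
have A : n%:R - 1 - 2 * mdist o (a t o) <= mdist o (a (g ^+ n)%g o).
  case: n => [|n]; first by rewrite act1 mdistxx; lra.
  have := chain_orbit_separation n H (translate_base AX t).
  have := mdist_triangle o (a t o) (a (g ^+ n.+1)%g o).
  have := mdist_sym o (a t o); rewrite -natr1; lra.
have : (1 + mdist o (a g o))^-1 * n%:R <= n%:R.
  by rewrite ler_piMl// invf_le1; lra.
by lra.
Qed.

(** Between two far apart closest orbit points, the geodesic has to cross a
    translate of the axis in between. *)
Lemma chain_crossing g t p0 q0 m L gamma s s' i n :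
  chain_at g t p0 q0 ->
  2 * mdist o (a t o) + 4 * C + mdist p0 o < m%:R ->
  2 * mdist o (a t o) + 4 * C + mdist q0 o < m%:R ->
  (m.+1 + m.+1 <= n)%N -> is_geodesic L gamma ->
  0 <= s -> s <= L -> 0 <= s' -> s' <= L ->
  (forall k, mdist (gamma s) (a (zexpg g i) o) <= mdist (gamma s) (a (zexpg g k) o)) ->
  (forall k, mdist (gamma s') (a (zexpg g (i + n%:Z)) o)
    <= mdist (gamma s') (a (zexpg g k) o)) ->
  exists u k, [/\ 0 <= u, u <= L &
    mdist (gamma u) (a (zexpg g k) o) <= 5 * C + mdist q0 o].
Proof.
move=> H mp mq mn Hg s0 sL s'0 s'L Hs Hs'; have C1 := axis_ge1 AX.
pose k := i + m.+1%:Z; pose c := zexpg g k.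
have [L' [gamma' [Hg' e0 e1 sub]]] := geodesic_join Hg s0 sL s'0 s'L.
pose T := translate a (c * t)%g X.
have [p Hp] := axis_translate_prox AX (c * t)%g (gamma s).
have [q Hq] := axis_translate_prox AX (c * t)%g (gamma s').
have A1 : mdist (a c^-1%g p) q0 <= 4 * C.
  apply: (chain_near_proj (chain_atV H) mq _ (translate_nearest_back Hp)).
  rewrite !act_distl invgK -actM.
  have -> : (c * g^-1 ^+ m.+1)%g = zexpg g i.
    by rewrite expVgn -[(g ^- m.+1)%g]/(zexpg g (Negz m)) -zexpgD NegzE /k addrK.
  exact: Hs.
have [l nE] : exists l, n = (m.+1 + l.+1)%N /\ (m <= l)%N.
  by exists (n - m.+1).-1; lia.
have A2 : mdist (a c^-1%g q) p0 <= 4 * C.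
  apply: (chain_near_proj (n := l) H _ _ (translate_nearest_back Hq)).
    by apply: lt_le_trans mp _; rewrite ler_nat; case: nE.
  rewrite !act_distl invgK -actM.
  have -> : (c * g ^+ l.+1)%g = zexpg g (i + n%:Z).
    by rewrite -[(g ^+ l.+1)%g]/(zexpg g l.+1%:Z) -zexpgD /k nE.1 PoszD addrA.
  exact: Hs'.
have pq : C < mdist p q.
  have := chain_far H; rewrite -(act_isometry a c^-1%g p q).
  have := mdist_triangle (a c^-1%g p) p0 q0.
  have := mdist_triangle (a c^-1%g q) p0 (a c^-1%g p).
  rewrite (mdist_sym p0 (a c^-1%g q)) (mdist_sym (a c^-1%g q) (a c^-1%g p)); lra.
have GT : gated C T := @gated_translate _ _ _ a _ _ _ (axis_gated AX).
have := GT _ _ Hg' p q; rewrite e0 e1 => /(_ Hp Hq pq).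
move=> [s1 [s2 [s10 s12 s2L A B]]].
have [v [v0 vL Ev]] := sub s1 s10 (le_trans s12 s2L).
exists v, k; split=> //; rewrite -Ev.
have := mdist_triangle p (gamma' s1) (a c o).
have := mdist_triangle (a c q0) p (a c o).
rewrite act_isometry (act_distr a c p q0); lra.
Qed.

(** The contraction constant depends on [g]: it only has to exceed the distance
    in [chain_crossing] and the length of the orbit segments too short for that
    lemma. *)
Lemma chain_contracting g t p0 q0 : chain_at g t p0 q0 ->
  contracting_element a o g.
Proof.
move=> H; split; last exact: chain_qi H.
have C1 := axis_ge1 AX.
have P1 := mdist_ge0 o (a g o); have P2 := mdist_ge0 q0 o.
(* After [m] steps from either end, [chain_near_proj] applies. *)
pose M := 2 * mdist o (a t o) + 4 * C + mdist p0 o + mdist q0 o.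
have P3 := mdist_ge0 o (a t o); have P4 := mdist_ge0 p0 o.
have [m mM] : exists m, M < m%:R.
  by exists (Num.trunc M).+1; exact: truncnS_gt.
pose D := 5 * C + mdist q0 o + 1 + (m.+1 + m.+1)%:R * mdist o (a g o).
have P5 : 0 <= (m.+1 + m.+1)%:R * mdist o (a g o) by rewrite mulr_ge0.
exists D; split; first by rewrite /D; lra.
move=> L gamma Hg far.
apply: ge_ereal_sup => _ [p [x + Hp] [q [y + Hq] <-]].
move=> -[s + sx] [s' + s'y]; rewrite /= !in_itv /= => /andP[s0 sL] /andP[s'0 s'L].
move: Hp Hq => /nearest_projP[[_ [i _ <-] <-] Hp] /nearest_projP[[_ [j _ <-] <-] Hq].
have far' u k : 0 <= u -> u <= L -> D <= mdist (gamma u) (a (zexpg g k) o).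
  move=> u0 uL; rewrite -lee_fin; apply: le_trans far _.
  apply: ereal_inf_lbound; exists (gamma u); first by exists u => //=; rewrite in_itv /= u0.
  by exists (a (zexpg g k) o) => //; exists (zexpg g k) => //; exists k.
have {}Hp k : mdist (gamma s) (a (zexpg g i) o) <= mdist (gamma s) (a (zexpg g k) o).
  by rewrite sx; apply: Hp; exists (zexpg g k) => //; exists k.
have {}Hq k : mdist (gamma s') (a (zexpg g j) o) <= mdist (gamma s') (a (zexpg g k) o).
  by rewrite s'y; apply: Hq; exists (zexpg g k) => //; exists k.
rewrite lee_fin {x sx y s'y}.
move: i j s s' s0 sL s'0 s'L Hp Hq.
apply: (int_leP (P := fun i j => forall s s', 0 <= s -> s <= L -> 0 <= s' ->
  s' <= L -> (forall k, mdist (gamma s) (a (zexpg g i) o) <=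
    mdist (gamma s) (a (zexpg g k) o)) ->
  (forall k, mdist (gamma s') (a (zexpg g j) o) <=
    mdist (gamma s') (a (zexpg g k) o)) ->
  mdist (a (zexpg g i) o) (a (zexpg g j) o) <= D))
  => [i j IH s s' *|i n s s' s0 sL s'0 s'L Hs Hs'].
  by rewrite mdist_sym; apply: (IH s' s).
rewrite zorbit_dist; case: (leqP n (m.+1 + m.+1)) => nm.
  have := orbit_upper g n; have : n%:R <= (m.+1 + m.+1)%:R :> R by rewrite ler_nat.
  by move=> /(ler_wpM2r P1); rewrite /D; lra.
have mp : 2 * mdist o (a t o) + 4 * C + mdist p0 o < m%:R by rewrite /M in mM; lra.
have mq : 2 * mdist o (a t o) + 4 * C + mdist q0 o < m%:R by rewrite /M in mM; lra.
have [u [k [u0 uL uk]]] :=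
  chain_crossing H mp mq (ltnW nm) Hg s0 sL s'0 s'L Hs Hs'.
by have := far' u k u0 uL; rewrite /D; lra.
Qed.

End Chain.

(** * Shortest elements of a conjugacy class *)

Section MinimalRepresentatives.
Context {R : realType} {G : groupType} {Y : metricType R}.
Variables (a : isometric_action G Y) (o : Y).
Variables (X : set Y) (E : set G) (C : R).
Hypothesis AX : barrier_axis a o X E C.
Implicit Types (x y z p q : Y) (f g t : G).

Definition shortest g := forall f,
  mdist o (a g o) <= mdist o (a (f^-1 * g * f)%g o).

Lemma dist_orbitV g : mdist o (a g^-1%g o) = mdist o (a g o).
Proof. by rewrite act_distr invgK mdist_sym. Qed.

Lemma shortestV g : shortest g -> shortest g^-1%g.
Proof.
move=> H f; rewrite dist_orbitV.
have -> : (f^-1 * g^-1 * f = (f^-1 * g * f)^-1)%g by rewrite !invgM invgK mulgA.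
by rewrite dist_orbitV; exact: H.
Qed.

Lemma translate_orbit t z : translate a t X z ->
  exists2 f, z = a f o & exists2 f0, stabilizes a f0 X & f = (t * f0)%g.
Proof.
move=> tz; have [f0 fX ez] := axis_orbit AX tz.
by exists (t * f0)%g; [rewrite actM -ez actVK|exists f0].
Qed.

Lemma shortest_displacement g t z : shortest g -> translate a t X z ->
  mdist o (a g o) <= mdist z (a g z).
Proof.
move=> Hg /translate_orbit [f -> _].
by have := Hg f; rewrite -mulgA !actM (act_distr a f^-1%g) invgK.
Qed.

(** A point of the axis is in the orbit of [o], so [g] moves it by at least the
    length of the shortest element [g]; hence the projection of [g z1] cannot
    undo the progress from [z1] to [z2] made along the axis. *)
Lemma shortest_progress g t z1 z2 p : shortest g ->
  C < mdist z1 z2 ->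
  nearest (translate a t X) o z1 -> nearest (translate a t X) (a g o) z2 ->
  nearest (translate a t X) (a g z1) p ->
  mdist z1 z2 + mdist z2 p <= mdist z1 p + 2 * C.
Proof.
move=> Hg z12 Hz1 Hz2 Hp; have C1 := axis_ge1 AX.
have HC := @axis_translate_contracts _ _ _ _ _ _ _ _ AX t.
have A1 := shortest_displacement Hg Hz1.1.
have A2 : mdist o z1 + mdist z1 z2 + mdist z2 (a g o) <= mdist o (a g o) + C.
  by case: (contractsP HC Hz1 Hz2) => //; lra.
have A3 := act_isometry a g o z1.
have := mdist_triangle (a g o) z2 (a g z1).
have := mdist_triangle p z1 (a g z1).
have := mdist_triangle p z1 z2.
have := mdist_ge0 p (a g z1); have := mdist_sym p z2.
case: (contractsP HC (nearest_self Hz2.1) Hp); rewrite ?mdistxx; lra.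
Qed.

Lemma shortest_displacement_le g t z1 z2 : shortest g -> C < mdist z1 z2 ->
  nearest (translate a t X) o z1 -> nearest (translate a t X) (a g o) z2 ->
  mdist z1 (a g z1) <= mdist o (a g o) + C.
Proof.
move=> Hg z12 Hz1 Hz2.
have HC := @axis_translate_contracts _ _ _ _ _ _ _ _ AX t.
have := mdist_triangle (a g o) z1 (a g z1).
have := mdist_triangle z2 z1 (a g o).
have := act_isometry a g o z1.
case: (contractsP HC Hz1 Hz2); lra.
Qed.

Lemma shortest_chain g t z1 z2 : shortest g -> 20 * C < mdist z1 z2 ->
  nearest (translate a t X) o z1 -> nearest (translate a t X) (a g o) z2 ->
  ~ E (t^-1 * (g * t))%g -> exists p0 q0, chain_at a X E C g t p0 q0.
Proof.
move=> Hg z12 Hz1 Hz2 nE; have C1 := axis_ge1 AX.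
have z12C : C < mdist z1 z2 by lra.
have [p Hp] := axis_translate_prox AX t (a g z1).
have [q Hq] := axis_translate_prox AX t (a g^-1%g z2).
have A1 := shortest_progress Hg z12C Hz1 Hz2 Hp.
exists p, q; split=> //.
- exists (a g z1) => //; apply/translate_act; exact: Hz1.1.
- exists (a g^-1%g z2) => //; apply/translate_act; exact: Hz2.1.
have HC := @axis_translate_contracts _ _ _ _ _ _ _ _ AX t.
have A2 : mdist q z1 + mdist z1 z2 <= mdist q z2 + 2 * C.
  have B1 := shortest_displacement (shortestV Hg) Hz2.1.
  rewrite dist_orbitV in B1.
  have B2 : mdist o z1 + mdist z1 z2 + mdist z2 (a g o) <= mdist o (a g o) + C.
    by case: (contractsP HC Hz1 Hz2) => //; lra.
  have B3 : mdist o (a g^-1%g z2) = mdist z2 (a g o) by rewrite act_distr invgK mdist_sym.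
  have := mdist_triangle o z1 (a g^-1%g z2).
  have := mdist_triangle q z2 (a g^-1%g z2).
  have := mdist_triangle q z2 z1.
  have := mdist_ge0 q (a g^-1%g z2); have := mdist_sym q z2.
  have := mdist_sym q z1; have := mdist_sym z1 z2; have := mdist_sym z1 o.
  case: (contractsP HC (nearest_self Hz1.1) Hq); rewrite ?mdistxx; lra.
have line := axis_line AX (e := 2 * C) _ Hq.1 Hz1.1 Hz2.1 Hp.1.
rewrite !act_isometry in line.
by have := line _ A2 A1; rewrite (mdist_sym p q) => /(_ ltac:(lra)); lra.
Qed.

(** The conjugating element carries [o] to the entry point [z1], which [g] moves
    by little more than its length. *)
Lemma parallel_conj g t z1 z2 : shortest g -> C < mdist z1 z2 ->
  nearest (translate a t X) o z1 -> nearest (translate a t X) (a g o) z2 ->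
  E (t^-1 * (g * t))%g ->
  exists f, E (f^-1 * g * f)%g /\
    mdist o (a (f^-1 * g * f)%g o) <= mdist o (a g o) + C.
Proof.
move=> Hg z12 Hz1 Hz2 Et.
have [f ef [f0 f0X eft]] := translate_orbit Hz1.1.
exists f; split.
  by have := axis_conj AX f0X Et; rewrite eft invgM !mulgA.
rewrite -mulgA !actM (act_distr a f^-1%g) invgK -ef.
exact: shortest_displacement_le Hz1 Hz2.
Qed.

(** A shortest element with a deep barrier either moves the barrier to a
    transverse one, and is then contracting, or is conjugate to an element of [E].
    The third case is stated for all conjugates because contraction is defined
    with the fixed basepoint [o]. *)
Lemma shortest_trichotomy g : shortest g ->
  [\/ barrier_free a o X (20 * C) g,
      exists f, E (f^-1 * g * f)%g /\
        mdist o (a (f^-1 * g * f)%g o) <= mdist o (a g o) + C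
    | forall f, contracting_element a o (f * g * f^-1)%g].
Proof.
move=> Hg; have C1 := axis_ge1 AX.
case: (pselect (barrier_free a o X (20 * C) g)) => B; first by constructor 1.
have : exists t z1 z2, [/\ nearest (translate a t X) o z1,
    nearest (translate a t X) (a g o) z2 & 20 * C < mdist z1 z2].
  apply: contrapT => N; apply: B => t p q Hp Hq; rewrite leNgt; apply/negP => pq.
  by apply: N; exists t, p, q.
move=> [t [z1 [z2 [Hz1 Hz2 z12]]]].
case: (pselect (E (t^-1 * (g * t))%g)) => Et.
  by constructor 2; apply: (parallel_conj Hg _ Hz1 Hz2 Et); lra.
constructor 3 => f.
have [p0 [q0 H]] := shortest_chain Hg z12 Hz1 Hz2 Et.
exact: (chain_contracting AX (chain_at_conj f H)).
Qed.

End MinimalRepresentatives.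

(** * Cardinality bounds and proper actions *)

(** Bounding duplicate-free lists avoids a separate proof of finiteness. *)
Definition card_bound {R : realType} {T : eqType} (A : set T) (r : R) : Prop :=
  forall l : seq T, uniq l -> (forall x, x \in l -> A x) -> (size l)%:R <= r.

Lemma finite_card_bound {R : realType} {T : choiceType} (A : set T) :
  finite_set A -> exists n : nat, card_bound A (n%:R : R).
Proof.
move=> /finite_seqP[s ->]; exists (size s) => l ul ls.
by rewrite ler_nat uniq_leq_size.
Qed.

Lemma seq_argmin {R : realType} {T : eqType} (f : T -> R) (s : seq T) x :
  x \in s -> exists2 y, y \in s & forall z, z \in s -> f y <= f z.
Proof.
elim: s x => // y s IH x _; case: s IH => [|z s] IH.
  by exists y => [|w]; rewrite ?mem_head// mem_seq1 => /eqP ->.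
have [w ws Hw] := IH z (mem_head _ _).
case: (lerP (f w) (f y)) => wy.
  exists w; first by rewrite inE ws orbT.
  by move=> v; rewrite inE => /orP[/eqP->//|]; exact: Hw.
exists y; first exact: mem_head.
move=> v; rewrite inE => /orP[/eqP->//|/Hw]; exact/le_trans/ltW.
Qed.

Section ProperActions.
Context {R : realType} {G : groupType} {Y : metricType R}.
Variables (a : isometric_action G Y).
Implicit Types (x y z p q : Y) (f g t : G).

Lemma finite_orbit_ball y z (r : R) : proper_space Y -> proper_action a ->
  finite_set [set g | mdist y (a g z) <= r].
Proof.
move=> PY Pa; apply: sub_finite_set (Pa (cball y (`|r| + mdist y z)) (PY _ _)).
move=> g /= yg; exists (a g z); split.
  by exists z => //; rewrite /cball /=; have := normr_ge0 r; lra.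
by rewrite /cball /=; have := ler_norm r; have := mdist_ge0 y z; lra.
Qed.

Lemma orbit_min y z (P : set G) : proper_space Y -> proper_action a ->
  P !=set0 -> exists2 g, P g & forall f, P f -> mdist y (a g z) <= mdist y (a f z).
Proof.
move=> PY Pa [g0 Pg0].
have /finite_seqP[s sE] : finite_set
    [set g | P g /\ mdist y (a g z) <= mdist y (a g0 z)].
  by apply: sub_finite_set (finite_orbit_ball y z (mdist y (a g0 z)) PY Pa) => g [].
have g0s : g0 \in s.
  by have : [set` s] g0 by rewrite -sE.
have [g gs Hg] := seq_argmin (fun g => mdist y (a g z)) g0s.
have [Pg gg0] : P g /\ mdist y (a g z) <= mdist y (a g0 z).
  by have : [set` s] g by []; rewrite -sE.
exists g => // f Pf; case: (lerP (mdist y (a f z)) (mdist y (a g0 z))) => ff0.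
  by apply: Hg; have : [set` s] f by rewrite -sE.
by apply: le_trans gg0 _; exact: ltW.
Qed.

Lemma orbit_attain y z (P : set G) (r : R) : proper_space Y -> proper_action a ->
  (forall e, 0 < e -> exists2 g, P g & mdist y (a g z) <= r + e) ->
  exists2 g, P g & mdist y (a g z) <= r.
Proof.
move=> PY Pa H; have [g0 Pg0 _] := H 1 ltr01.
have [g Pg Hg] := orbit_min y z PY Pa (ex_intro P g0 Pg0).
exists g => //; rewrite leNgt; apply/negP => rg.
have [|f Pf] := H ((mdist y (a g z) - r) / 2); first by lra.
by have := Hg f Pf; lra.
Qed.

End ProperActions.

(** * Coarse betweenness along a quasi-geodesic *)

Section Betweenness.
Context {R : realType} {Y : metricType R}.
Implicit Types (f : int -> Y).

(** In-between indices are metrically in between, up to [D]. *)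
Definition monotone_along f (D : R) := forall i j k, (i <= j <= k)%R ->
  mdist (f i) (f j) + mdist (f j) (f k) <= mdist (f i) (f k) + D.

Lemma monotone_along_opp f D : monotone_along f D ->
  monotone_along (fun i => f (- i)) D.
Proof.
move=> H i j k /andP[ij jk].
have /(_ _) := H (- k) (- j) (- i); rewrite !lerN2 ij jk => /(_ isT).
rewrite (mdist_sym (f (- k)) (f (- j))) (mdist_sym (f (- j)) (f (- i))).
by rewrite (mdist_sym (f (- k)) (f (- i))); lra.
Qed.

(** By coarse betweenness, [f ip] lies beyond [f i2] or near it, and [f iq] beyond
    [f i1] or near it. *)
Lemma monotone_line_le f D e i1 i2 iq ip : monotone_along f D ->
  0 <= e -> (i1 <= i2)%R ->
  mdist (f iq) (f i1) + mdist (f i1) (f i2) <= mdist (f iq) (f i2) + e ->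
  mdist (f i1) (f i2) + mdist (f i2) (f ip) <= mdist (f i1) (f ip) + e ->
  mdist (f i1) (f i2) <= mdist (f iq) (f ip) + 2 * e + D.
Proof.
move=> H e0 i12 Hq Hp.
have D0 : 0 <= D.
  by have := H i1 i1 i1; rewrite lexx mdistxx => /(_ isT); lra.
have := mdist_ge0 (f iq) (f ip).
have := mdist_triangle (f iq) (f i1) (f ip).
have := mdist_triangle (f ip) (f i1) (f i2).
have := mdist_triangle (f ip) (f iq) (f i2).
have := mdist_triangle (f iq) (f i1) (f i2).
have := mdist_sym (f i1) (f iq); have := mdist_sym (f i1) (f ip).
have := mdist_sym (f i2) (f iq); have := mdist_sym (f i2) (f ip).
have := mdist_sym (f iq) (f ip).
have := mdist_ge0 (f i1) (f i2); have := mdist_ge0 (f iq) (f i1).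
have := mdist_ge0 (f ip) (f i2).
have P1 : (ip <= i1)%R -> mdist (f ip) (f i1) + mdist (f i1) (f i2) <= mdist (f ip) (f i2) + D.
  by move=> A; apply: H; rewrite A.
have P2 : (i1 <= ip <= i2)%R -> mdist (f i1) (f ip) + mdist (f ip) (f i2) <= mdist (f i1) (f i2) + D.
  exact: H.
have Q1 : (i2 <= iq)%R -> mdist (f i1) (f i2) + mdist (f i2) (f iq) <= mdist (f i1) (f iq) + D.
  by move=> A; apply: H; rewrite A i12.
have Q2 : (i1 <= iq <= i2)%R -> mdist (f i1) (f iq) + mdist (f iq) (f i2) <= mdist (f i1) (f i2) + D.
  exact: H.
have PQ : (i2 <= ip)%R -> (iq <= i1)%R ->
    mdist (f iq) (f i1) + mdist (f i1) (f ip) <= mdist (f iq) (f ip) + D.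
  by move=> A B; apply: H; rewrite B (le_trans i12 A).
case: (lerP ip i1) => A1; first by move/(_ A1): P1; lra.
case: (lerP ip i2) => A2.
  move: P2; rewrite A2 (ltW A1) => /(_ isT) {}P2.
  case: (lerP i2 iq) => B1; first by move/(_ B1): Q1; lra.
  case: (lerP i1 iq) => B2; last by lra.
  by move: Q2; rewrite B2 (ltW B1) => /(_ isT); lra.
case: (lerP i2 iq) => B1; first by move/(_ B1): Q1; lra.
case: (lerP i1 iq) => B2; last by move: (PQ (ltW A2) (ltW B2)); lra.
by move: Q2; rewrite B2 (ltW B1) => /(_ isT); lra.
Qed.

Lemma monotone_line f D e i1 i2 iq ip : monotone_along f D -> 0 <= e ->
  mdist (f iq) (f i1) + mdist (f i1) (f i2) <= mdist (f iq) (f i2) + e ->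
  mdist (f i1) (f i2) + mdist (f i2) (f ip) <= mdist (f i1) (f ip) + e ->
  mdist (f i1) (f i2) <= mdist (f iq) (f ip) + 2 * e + D.
Proof.
move=> H e0 Hq Hp; case: (lerP i1 i2) => i12; first exact: monotone_line_le H _ _ _ _.
have H' := monotone_along_opp H.
have := @monotone_line_le _ D e (- i1) (- i2) (- iq) (- ip) H' e0.
by rewrite lerN2 !opprK; apply=> //; exact: ltW.
Qed.

(** A discrete intermediate value theorem: the indices of the points that
    shadow a geodesic move by bounded jumps, hence come close to every
    intermediate index. *)
Lemma quasigeodesic_monotone f (lambda c r : R) : geodesic_space Y ->
  1 <= lambda -> 0 <= c -> 0 <= r ->
  (forall m n : int, lambda^-1 * `|m - n|%:~R - c <= mdist (f m) (f n) <=
    lambda * `|m - n|%:~R + c) ->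
  (forall L gamma i k t, is_geodesic L gamma -> gamma 0 = f i -> gamma L = f k ->
    0 <= t -> t <= L -> exists n, mdist (gamma t) (f n) <= r) ->
  exists2 D, 0 <= D & monotone_along f D.
Proof.
move=> HY l1 c0 r0 qi qc.
(* The index moves by at most [J] in one unit of time. *)
pose J := lambda * (1 + 2 * r + c).
have idx m n d : mdist (f m) (f n) <= d -> `|m - n|%:~R <= lambda * (d + c).
  move=> mn; have /andP[+ _] := qi m n => A.
  by rewrite mulrC -ler_pdivrMr ?(mulrC _ lambda^-1); lra.
have J0 : 0 <= J by rewrite /J mulr_ge0; lra.
have lJ0 : 0 <= lambda * J by rewrite mulr_ge0; lra.
exists (2 * (r + lambda * J + c)); first by lra.
move=> i j k /andP[ij jk].
have [L [gamma [Hg g0 gL]]] := HY (f i) (f k).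
have L0 := geodesic_ge0 Hg.
have [t [n [t0 tL tn nj]]] : exists t n, [/\ 0 <= t, t <= L,
    mdist (gamma t) (f n) <= r & `|n - j|%:~R <= J].
  apply: contrapT => N.
  have far t n : 0 <= t -> t <= L -> mdist (gamma t) (f n) <= r ->
      `|n - j|%:~R <= J -> False.
    by move=> *; apply: N; exists t, n.
  have below u n : mdist (gamma (Num.min u%:R L)) (f n) <= r -> (n < j)%R.
    have min0 v : 0 <= Num.min (v%:R : R) L by rewrite le_min L0 ler0n.
    have minL v : Num.min (v%:R : R) L <= L by rewrite ge_min lexx orbT.
    elim: u n => [|u IH] n Hn; rewrite ltNge; apply/negP => jn.
      have E0 : Num.min (0%:R : R) L = 0 by apply/min_idPl.
      apply: (far _ n (min0 0) (minL 0) Hn).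
      rewrite E0 g0 in Hn; have := idx _ _ _ Hn.
      have : `|n - j|%:~R <= `|i - n|%:~R :> R by rewrite ler_int; lia.
      have : lambda * (r + c) <= J by rewrite /J ler_wpM2l; lra.
      by lra.
    have [n' Hn'] := qc L gamma i k _ Hg g0 gL (min0 u) (minL u).
    have n'j := IH _ Hn'.
    apply: (far _ n (min0 u.+1) (minL u.+1) Hn).
    have uu : Num.min (u%:R : R) L <= Num.min u.+1%:R L.
      by rewrite le_min !ge_min lexx orbT andbT ler_nat leqnSn.
    have E := geodesic_dist Hg (min0 u) uu (minL _).
    have uu1 : Num.min (u.+1%:R : R) L - Num.min (u%:R) L <= 1.
      rewrite -natr1; case: (lerP u%:R L) => A; case: (lerP (u%:R + 1) L) => B; lra.
    have : mdist (f n') (f n) <= 1 + 2 * r.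
      have := mdist_triangle (gamma (Num.min u%:R L)) (f n') (f n).
      have := mdist_triangle (gamma (Num.min u.+1%:R L)) (gamma (Num.min u%:R L)) (f n).
      have := mdist_sym (f n') (gamma (Num.min u%:R L)); lra.
    move=> /idx; rewrite -/J.
    have : `|n - j|%:~R <= `|n' - n|%:~R :> R by rewrite ler_int; lia.
    by lra.
  have : (k < j)%R.
    apply: (below (Num.trunc L).+1); rewrite (_ : Num.min _ _ = L).
      by rewrite gL mdistxx.
    by apply/min_idPr/ltW/truncnS_gt.
  by rewrite ltNge jk.
have nj' : mdist (f n) (f j) <= lambda * J + c.
  have /andP[_ +] := qi n j; have : lambda * `|n - j|%:~R <= lambda * J.
    by rewrite ler_wpM2l //; lra.
  by lra.
have E1 := geodesic_dist Hg (lexx 0) t0 tL; have E2 := geodesic_dist Hg t0 tL (lexx L).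
have E3 := geodesic_dist Hg (lexx 0) L0 (lexx L).
rewrite g0 in E1 E3; rewrite gL in E2 E3.
have := mdist_triangle (gamma t) (f i) (f j).
have := mdist_triangle (gamma t) (f j) (f k).
have := mdist_triangle (f n) (gamma t) (f j).
have := mdist_sym (gamma t) (f j); lra.
Qed.

End Betweenness.

(** * The axis of a contracting element *)

Section AxisOfContractingElement.
Context {R : realType} {G : groupType} {Y : metricType R}.
Variables (a : isometric_action G Y) (o : Y) (h : G).
Implicit Types (x y z p q : Y) (f g t : G).

Definition axis : set Y := orbit_set a o (cyclic_subgroup h).

Local Notation pt n := (a (zexpg h n) o).

Lemma axisP x : axis x <-> exists n, x = pt n.
Proof.
split=> [[_ [n _ <-] <-]|[n ->]]; first by exists n.
by exists (zexpg h n) => //; exists n.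
Qed.

Lemma axis_pt n : axis (pt n).
Proof. by apply/axisP; exists n. Qed.

Lemma axis_stab n : stabilizes a (zexpg h n) axis.
Proof.
apply/funext => y; apply/propext; split.
  move=> /axisP[m Em]; apply/axisP; exists (n + m).
  by rewrite zexpgD actM -Em actVK.
move=> /axisP[m ->]; apply/axisP; exists (- n + m).
by rewrite zexpgD actM zexpgN.
Qed.

Lemma proximinal_axis : proper_space Y -> proper_action a -> proximinal axis.
Proof.
move=> PY Pa x.
have [|g [n _ <-] H] := orbit_min (P := cyclic_subgroup h) x o PY Pa.
  by exists (zexpg h 0); exists 0.
exists (pt n); split; first exact: axis_pt.
by move=> _ /axisP[m ->]; apply: H; exists m.
Qed.

Definition parallel (B : R) : set G := [set g |
  (forall x, axis x -> exists2 y, axis y & mdist (a g x) y <= B) /\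
  (forall y, axis y -> exists2 x, axis x & mdist (a g x) y <= B)].

Lemma parallelV B g : parallel B g -> parallel B g^-1%g.
Proof.
move=> [H1 H2]; split=> x Ax.
  have [y Ay H] := H2 x Ax; exists y => //.
  by rewrite mdist_sym -(act_isometry a g) actVK.
have [y Ay H] := H1 x Ax; exists y => //.
by rewrite mdist_sym -(act_isometry a g) actVK.
Qed.

Lemma stab_mem f x : stabilizes a f axis -> axis x -> axis (a f x).
Proof. by move=> fX Ax; rewrite -fX; apply/translate_mem. Qed.

Lemma parallel_conj_stab B f g : stabilizes a f axis -> parallel B g ->
  parallel B (f^-1 * g * f)%g.
Proof.
move=> fX [H1 H2]; have fX' := stabilizesV fX; split=> x Ax.
  have [y Ay H] := H1 _ (stab_mem fX Ax); exists (a f^-1%g y).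
    exact: stab_mem Ay.
  by rewrite -mulgA !actM act_isometry.
have [y Ay H] := H2 _ (stab_mem fX Ax); exists (a f^-1%g y).
  exact: stab_mem Ay.
by rewrite -mulgA !actM actVK act_distl invgK.
Qed.

Lemma dist_shadow x y u v (r d : R) : mdist x u <= r -> mdist y v <= r ->
  mdist x y = d -> d - 2 * r <= mdist u v /\ mdist u v <= d + 2 * r.
Proof.
move=> xu yv <-; have := mdist_triangle x u v; have := mdist_triangle y x v.
have := mdist_triangle u x y; have := mdist_triangle v u y.
have := mdist_sym x u; have := mdist_sym y v; lra.
Qed.

Lemma pigeonhole (T : eqType) (A : set T) (N : nat) (w : nat -> T) :
  card_bound A (N%:R : R) -> (forall i, (i <= N)%N -> A (w i)) ->
  exists i j, [/\ (i < j)%N, (j <= N)%N & w i = w j].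
Proof.
move=> HA Hw; apply: contrapT => H.
have inj i j : (i <= N)%N -> (j <= N)%N -> w i = w j -> i = j.
  move=> iN jN wij; case: (ltngtP i j) => // ij; exfalso; apply: H.
    by exists i, j.
  by exists j, i.
have := HA (map w (iota 0 N.+1)).
rewrite size_map size_iota map_inj_in_uniq ?iota_uniq; last first.
  by move=> i j; rewrite !mem_iota !add0n !ltnS => iN jN; exact: inj.
move=> /(_ isT) H'; have : N.+1%:R <= N%:R :> R.
  apply: H' => x /mapP[i]; rewrite mem_iota add0n ltnS => iN ->; exact: Hw.
by rewrite ler_nat ltnn.
Qed.

Section Commensuration.
Variables (lambda c : R).
Hypotheses (lambda1 : 1 <= lambda) (c0 : 0 <= c)
  (qi : forall m n : int, lambda^-1 * `|m - n|%:~R - c <= mdist (pt m) (pt n) <=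
    lambda * `|m - n|%:~R + c).

Lemma axis_index m n d : mdist (pt m) (pt n) <= d ->
  `|m - n|%:~R <= lambda * (d + c).
Proof.
move=> mn; have l1 := lambda1; have /andP[+ _] := qi m n => A.
by rewrite mulrC -ler_pdivrMr ?(mulrC _ lambda^-1); lra.
Qed.

Lemma axis_dist_le m n d : `|m - n|%:~R <= d -> mdist (pt m) (pt n) <= lambda * d + c.
Proof.
move=> mn; have /andP[_ A] := qi m n; apply: le_trans A _.
by rewrite lerD2r ler_wpM2l //; have := lambda1; lra.
Qed.

(** The relation says that [g] conjugates a power of [h] to a power of [h], so
    one point of the translate that is close to the axis propagates periodically
    along both. *)
Lemma commensurated_parallel g (P Q : int) m n (P0 r : R) :
  (g * zexpg h P = zexpg h Q * g)%g -> P != 0 -> Q != 0 ->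
  `|P|%:~R <= P0 -> `|Q|%:~R <= P0 ->
  mdist (a g (pt n)) (pt m) <= r -> parallel (lambda * P0 + c + r) g.
Proof.
move=> PQ P0' Q0' PP QP mn.
have PQk k : (g * zexpg h (P * k) = zexpg h (Q * k) * g)%g.
  rewrite !zexpgM; have -> : zexpg h Q = (g * zexpg h P * g^-1)%g.
    by rewrite PQ mulgK.
  by rewrite zexpg_conj mulgVK.
split=> [_ /axisP[l ->]|_ /axisP[l ->]].
- pose k := ((l - n) %/ P)%Z; pose e := ((l - n) %% P)%Z.
  have El : l = P * k + (n + e) by rewrite /k /e; have := divz_eq (l - n) P; lia.
  exists (pt (Q * k + m)); first exact: axis_pt.
  have -> : a g (pt l) = a (zexpg h (Q * k)) (a g (pt (n + e))).
    by rewrite -!actM El (zexpgD h _ (n + e)) !mulgA PQk.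
  rewrite [zexpg h (Q * k + m)]zexpgD actM act_isometry.
  have := mdist_triangle (a g (pt n)) (a g (pt (n + e))) (pt m).
  rewrite act_isometry.
  have : mdist (pt (n + e)) (pt n) <= lambda * P0 + c.
    apply: axis_dist_le; apply: le_trans PP; rewrite ler_int.
    have -> : n + e - n = e by lia.
    by rewrite ger0_norm ?modz_ge0// ltW// ltz_mod.
  by lra.
- pose k := ((l - m) %/ Q)%Z; pose e := ((l - m) %% Q)%Z.
  have El : l = Q * k + (m + e) by rewrite /k /e; have := divz_eq (l - m) Q; lia.
  exists (pt (P * k + n)); first exact: axis_pt.
  have -> : a g (pt (P * k + n)) = a (zexpg h (Q * k)) (a g (pt n)).
    by rewrite -!actM zexpgD !mulgA PQk.
  rewrite El [zexpg h (Q * k + _)]zexpgD actM act_isometry.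
  have := mdist_triangle (pt m) (a g (pt n)) (pt (m + e)).
  have : mdist (pt m) (pt (m + e)) <= lambda * P0 + c.
    apply: axis_dist_le; apply: le_trans QP; rewrite ler_int.
    have -> : m - (m + e) = - e by lia.
    by rewrite normrN ger0_norm ?modz_ge0// ltW// ltz_mod.
  by lra.
Qed.

(** A long projection of [g X] to [X] yields a geodesic segment along which both
    sets run within distance [r]. At points of the segment that are [sigma] apart,
    indices [m], [n] of nearby points give elements h^-m g h^n of a finite ball;
    two of them coincide, and this is the relation of
    [commensurated_parallel]. *)
Lemma parallel_or_bounded C : proper_space Y -> geodesic_space Y ->
  proper_action a -> 0 <= C -> gated C axis -> contracts C axis ->
  exists2 B, 0 <= B & forall g, parallel B g \/
    bounded_proj B axis (translate a g axis).
Proof.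
move=> PY HY Pa C0 HG HC; have l1 := lambda1; have c0' := c0.
(* [r] bounds the distances to both sets along the segment, and [sigma > 2 * r]
   makes the indices found at different times distinct. *)
pose r := 4 * C.
have [N HN] := @finite_card_bound R _ _ (finite_orbit_ball o o (2 * r) PY Pa).
pose sigma := 2 * r + 1; pose T := N%:R * sigma.
have T0 : 0 <= T by rewrite /T /sigma mulr_ge0 ?ler0n // /r; lra.
pose P0 := lambda * (T + 2 * r + c).
have P00 : 0 <= P0 by rewrite /P0 mulr_ge0 // /r; lra.
have lP0 : 0 <= lambda * P0 by rewrite mulr_ge0//; lra.
exists (lambda * P0 + c + 2 * r + T + 3 * C); first by rewrite /r; lra.
move=> g; set B := _ + 3 * C; case: (pselect (bounded_proj B axis (translate a g axis))).
  by right.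
move=> NB; left.
have [x [y [p [q [gx gy Hp Hq pq]]]]] : exists x y p q,
    [/\ translate a g axis x, translate a g axis y, nearest axis x p,
        nearest axis y q & B < mdist p q].
  apply: contrapT => N'; apply: NB => x y p q gx gy Hp Hq; rewrite leNgt.
  by apply/negP => pq; apply: N'; exists x, y, p, q.
have prox := proximinal_axis PY Pa.
have [L [gamma [Hg g0 gL]]] := HY x y.
have := HG L gamma Hg p q; rewrite g0 gL => /(_ Hp Hq).
case; first by rewrite /B /r in pq; lra.
move=> s1 [s2 [s10 s12 s2L s1p s2q]].
have D12 := geodesic_dist Hg s10 s12 s2L.
have s12T : T <= s2 - s1.
  have := mdist_triangle (gamma s1) p q; have := mdist_triangle (gamma s2) (gamma s1) q.
  have := mdist_sym (gamma s1) p; rewrite /B /r in pq; lra.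
have geoT u : 0 <= u -> u <= T ->
    mdist (gamma s1) (gamma (s1 + u)) + mdist (gamma (s1 + u)) (gamma s2)
    <= mdist (gamma s1) (gamma s2).
  move=> u0 uT; rewrite !(geodesic_dist Hg); lra.
have geoL u : 0 <= u -> u <= T ->
    mdist x (gamma (s1 + u)) + mdist (gamma (s1 + u)) y <= mdist x y.
  move=> u0 uT; rewrite -g0 -gL !(geodesic_dist Hg); lra.
have near1 u : 0 <= u -> u <= T -> exists m, mdist (gamma (s1 + u)) (pt m) <= r.
  move=> u0 uT; have [w Hw] := prox (gamma (s1 + u)).
  have /axisP[m Em] := Hw.1; exists m; rewrite -Em.
  have := contracts_quasiconvex HC C0 prox C0 Hp.1 Hq.1 s1p s2q Hw (geoT u u0 uT).
  by rewrite /r; lra.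
have near2 u : 0 <= u -> u <= T -> exists n, mdist (gamma (s1 + u)) (a g (pt n)) <= r.
  move=> u0 uT.
  have HCg := @contracts_translate _ _ _ a g _ _ HC.
  have proxg := @proximinal_translate _ _ _ a g _ prox.
  have [w Hw] := proxg (gamma (s1 + u)).
  have /axisP[n En] := Hw.1; exists n; rewrite -En actVK.
  have xx : mdist x x <= 0 by rewrite mdistxx.
  have yy : mdist y y <= 0 by rewrite mdistxx.
  have := contracts_quasiconvex HCg C0 proxg (lexx 0) gx gy xx yy Hw (geoL u u0 uT).
  by rewrite /r; lra.
have sig0 : 0 <= sigma by rewrite /sigma /r; lra.
have : forall i : nat, exists mn : int * int, (i <= N)%N ->
    mdist (gamma (s1 + i%:R * sigma)) (pt mn.1) <= r /\
    mdist (gamma (s1 + i%:R * sigma)) (a g (pt mn.2)) <= r.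
  move=> i; case: (leqP i N) => iN; last by exists (0, 0).
  have i0 : 0 <= i%:R * sigma by rewrite mulr_ge0.
  have iT : i%:R * sigma <= T by rewrite /T ler_wpM2r // ler_nat.
  have [m Hm] := near1 _ i0 iT; have [n Hn] := near2 _ i0 iT.
  by exists (m, n).
move=> /choice[mn Hmn].
pose w i := (zexpg h (- (mn i).1) * g * zexpg h (mn i).2)%g.
have gm i : (i <= N)%N -> mdist (a g (pt (mn i).2)) (pt (mn i).1) <= 2 * r.
  move=> /Hmn[A1 A2].
  have := mdist_triangle (gamma (s1 + i%:R * sigma)) (a g (pt (mn i).2)) (pt (mn i).1).
  have := mdist_sym (a g (pt (mn i).2)) (gamma (s1 + i%:R * sigma)); lra.
have wball i : (i <= N)%N -> mdist o (a (w i) o) <= 2 * r.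
  move=> iN; rewrite /w -mulgA !actM act_distr zexpgN invgK mdist_sym.
  exact: gm.
have [i [j [ij jN wij]]] := pigeonhole HN wball.
have iN : (i <= N)%N by apply: leq_trans (ltnW ij) jN.
pose P := (mn j).2 - (mn i).2; pose Q := (mn j).1 - (mn i).1.
have PQ : (g * zexpg h P = zexpg h Q * g)%g.
  have E : (zexpg h (mn j).1 * w i * zexpg h (- (mn i).2) =
            zexpg h (mn j).1 * w j * zexpg h (- (mn i).2))%g by rewrite wij.
  move: E; rewrite /w /P /Q !zexpgD !zexpgN !mulgA mulgK => ->.
  by rewrite mulgV mul1g.
have [A1 A2] := Hmn _ iN; have [A3 A4] := Hmn _ jN.
have ijs : i%:R * sigma + sigma <= j%:R * sigma.
  by rewrite -[X in _ + X]mul1r -mulrDl ler_wpM2r// natr1 ler_nat.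
have i0 : 0 <= i%:R * sigma by rewrite mulr_ge0.
have jT : j%:R * sigma <= T by rewrite /T ler_wpM2r // ler_nat.
have Dij : mdist (gamma (s1 + i%:R * sigma)) (gamma (s1 + j%:R * sigma)) =
    j%:R * sigma - i%:R * sigma.
  rewrite (geodesic_dist Hg); lra.
have dT : j%:R * sigma - i%:R * sigma <= T by lra.
have dsigma : 2 * r < j%:R * sigma - i%:R * sigma by move: ijs; rewrite {2}/sigma; lra.
have [B1 B2] := dist_shadow A1 A3 Dij; have [B3 B4] := dist_shadow A2 A4 Dij.
move: (j%:R * sigma - i%:R * sigma) dT dsigma B1 B2 B3 B4 => d dT dsigma B1 B2 B3 B4.
have Q0' : Q != 0.
  rewrite /Q subr_eq0; apply/eqP => Eij.
  by move: B1; rewrite Eij mdistxx subr_le0 leNgt dsigma.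
have P0' : P != 0.
  rewrite /P subr_eq0; apply/eqP => Eij.
  by move: B3; rewrite Eij mdistxx subr_le0 leNgt dsigma.
have PP : `|P|%:~R <= P0.
  apply: axis_index; rewrite -(act_isometry a g) mdist_sym.
  by apply: le_trans B4 _; rewrite lerD2r.
have QP : `|Q|%:~R <= P0.
  by apply: axis_index; rewrite mdist_sym; apply: le_trans B2 _; rewrite lerD2r.
have [H1 H2] := commensurated_parallel PQ P0' Q0' PP QP (gm i iN).
by split=> z Az; [have [z' Az' zz'] := H1 z Az|have [z' Az' zz'] := H2 z Az];
  exists z' => //; apply: le_trans zz' _; by rewrite /B -(addrA _ T) lerDl addr_ge0 // mulr_ge0.
Qed.

(** An element of [parallel B] is a power of [h] times an element of a fixed ball,
    and the power is controlled by the length. *)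
Lemma card_parallel B : proper_space Y -> proper_action a -> 0 <= B ->
  exists2 A, 0 <= A & forall r, 0 <= r ->
    card_bound [set g | parallel B g /\ mdist o (a g o) <= r] (A * (1 + r)).
Proof.
move=> PY Pa B0; have l1 := lambda1; have c0' := c0.
have /finite_seqP[s sE] := finite_orbit_ball o o B PY Pa.
have lB : 0 <= lambda * (1 + B + c) by apply: mulr_ge0; lra.
exists ((size s)%:R * (2 * (lambda * (1 + B + c)) + 3)).
  by apply: mulr_ge0 => //; lra.
move=> r r0 l ul Hl.
pose k := (Num.trunc (lambda * (r + B + c))).+1.
pose I := [seq (i%:Z - k%:Z) | i <- iota 0 (k + k).+1].
have sub : {subset l <= [seq (zexpg h m * f)%g | m <- I, f <- s]}.
  move=> e /Hl [[He1 _] er]; have [|y /axisP[m ->] om] := He1 (pt 0).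
    exact: axis_pt.
  rewrite /= act1 in om; apply/allpairsP; exists (m, (zexpg h (- m) * e)%g).
  split=> /=; last by rewrite zexpgN mulVKg.
  - have mk : `|m|%:~R <= lambda * (r + B + c).
      have := @axis_index m 0 (r + B); rewrite subr0; apply.
      have := mdist_triangle (a e o) (pt m) (pt 0).
      rewrite [zexpg h 0]/= act1; have := mdist_sym (pt m) (a e o).
      have := mdist_sym (a e o) o; lra.
    have {}mk : `|m|%:~R < k%:R :> R by apply: le_lt_trans mk (truncnS_gt _).
    have {}mk : (`|m| < k%:Z)%R by move: mk; rewrite pmulrn ltr_int.
    apply/mapP; exists (absz (m + k%:Z)); last by clear -mk; lia.
    by rewrite mem_iota add0n; clear -mk; lia.
  - have : [set` s] (zexpg h (- m) * e)%g; last by [].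
    rewrite -sE /= actM act_distr zexpgN invgK mdist_sym.
    exact: om.
have := uniq_leq_size ul sub; rewrite size_allpairs size_map size_iota.
rewrite -(ler_nat R) => /le_trans; apply.
rewrite mulnC natrM -mulrA ler_wpM2l//.
have lr : 0 <= lambda * (r + B + c) by apply: mulr_ge0; lra.
have : k%:R <= lambda * (r + B + c) + 1.
  by rewrite /k -natr1 lerD2r; have /andP[] := truncn_itv lr.
have : lambda * (r + B + c) <= lambda * (1 + B + c) * (1 + r).
  rewrite -mulrA; apply: ler_wpM2l; first by lra.
  have rB : 0 <= r * (B + c) by apply: mulr_ge0; lra.
  by lra.
have lBr : 0 <= lambda * (1 + B + c) * r by apply: mulr_ge0.
by rewrite -natr1 natrD; lra.
Qed.

End Commensuration.

Lemma axis_barrier : proper_space Y -> geodesic_space Y -> proper_action a ->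
  contracting_element a o h ->
  exists E C, barrier_axis a o axis E C /\
   exists2 A, 0 <= A & forall r, 0 <= r ->
    card_bound [set g | E g /\ mdist o (a g o) <= r] (A * (1 + r)).
Proof.
move=> PY HY Pa [[C0 [C01 HC0]] [lambda [c [l1 c0 qi]]]].
have prox := proximinal_axis PY Pa.
have HG0 := contracting_gated C01 HC0 prox.
pose C1 := 4 * (2 * C0 + 2).
have HG : gated C1 axis by apply: gated_le HG0; rewrite /C1; lra.
have HC : contracts C1 axis.
  by apply: (gated_contracts HY _ HG0); lra.
have C10 : 0 <= C1 by rewrite /C1; lra.
have [B B0 HB] := parallel_or_bounded l1 c0 qi PY HY Pa C10 HG HC.
have [D D0 HD] : exists2 D, 0 <= D & monotone_along (fun n : int => pt n) D.
  apply: (quasigeodesic_monotone (r := 2 * C1) HY l1 c0 _ qi); first by lra.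
  move=> L gamma i k t Hg g0 gL t0 tL.
  have [w Hw] := prox (gamma t); have /axisP[n En] := Hw.1; exists n; rewrite -En.
  have ii : mdist (pt i) (pt i) <= 0 by rewrite mdistxx.
  have kk : mdist (pt k) (pt k) <= 0 by rewrite mdistxx.
  have al : mdist (pt i) (gamma t) + mdist (gamma t) (pt k) <= mdist (pt i) (pt k).
    rewrite -g0 -gL !(geodesic_dist Hg) //; first by lra.
    exact: geodesic_ge0 Hg.
  have := contracts_quasiconvex HC C10 prox (lexx 0) (axis_pt i) (axis_pt k) ii kk Hw al.
  by lra.
exists (parallel B), (C1 + B + D); split; last exact: card_parallel l1 c0 qi _ _ _ _.
split.
- by rewrite /C1; lra.
- by apply/axisP; exists 0; rewrite act1.
- exact: prox.
- by apply: gated_le HG; lra.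
- by apply: contracts_le HC; lra.
- by move=> z /axisP[n ->]; exists (zexpg h n) => //; exact: axis_stab.
- move=> g nE; case: (HB g) => // H x y p q gx gy Hp Hq.
  by have := H x y p q gx gy Hp Hq; lra.
- exact: parallelV.
- exact: parallel_conj_stab.
- move=> g x [_ H2] Ax; have [y Ay H] := H2 x Ax.
  by exists (a g y); [apply/translate_mem|rewrite mdist_sym; lra].
- move=> e q z1 z2 p e0 /axisP[iq ->] /axisP[i1 ->] /axisP[i2 ->] /axisP[ip ->] H1 H2.
  by have := monotone_line HD e0 H1 H2; lra.
- move=> r; pose n := (Num.trunc (lambda * (`|r| + c))).+1.
  exists (zexpg h n%:Z); first exact: axis_stab.
  have /andP[+ _] := qi 0 n%:Z; rewrite [zexpg h 0]/= act1 sub0r normrN.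
  apply: lt_le_trans; have : lambda * (`|r| + c) < n%:R by exact: truncnS_gt.
  rewrite mulrC -ltr_pdivlMr; last by lra.
  by rewrite mulrC /= => A; have := ler_norm r; rewrite -[(n%:Z)%:~R]/(n%:R); lra.
Qed.

End AxisOfContractingElement.

(** * Series as bounds on finite sums *)

Section FiniteSums.
Context {R : realType}.

(** Summability of a nonnegative family with sum at most [S]. *)
Definition sum_bound {T : eqType} (A : set T) (f : T -> R) (S : R) : Prop :=
  forall l : seq T, uniq l -> (forall x, x \in l -> A x) ->
  \sum_(x <- l) f x <= S.

Lemma sum_bound_ge0 (T : eqType) (A : set T) f S : sum_bound A f S -> 0 <= S.
Proof. by move=> /(_ [::] isT); rewrite big_nil; apply. Qed.

Lemma ler_sum_subset (T : eqType) (f : T -> R) (l m : seq T) :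
  (forall x, 0 <= f x) -> uniq l -> {subset l <= m} ->
  \sum_(x <- l) f x <= \sum_(x <- m) f x.
Proof.
move=> f0 ul lm; apply: (@le_trans _ _ (\sum_(x <- undup m) f x)).
  rewrite [leRHS](bigID (fun x => x \in l)) /= -[leLHS]addr0; apply: lerD.
    rewrite -[leRHS]big_filter le_eqVlt; apply/orP; left; apply/eqP; apply: perm_big.
    apply: uniq_perm => //; first by rewrite filter_uniq ?undup_uniq.
    move=> x; rewrite mem_filter mem_undup; case: (boolP (x \in l)) => //= /lm.
    by move=> ->.
  by apply: sumr_ge0.
elim: m {ul lm} => //= x m IH; case: ifP => _; rewrite !big_cons ?lerD//.
by apply: le_trans IH _; rewrite lerDr.
Qed.

Lemma sum_boundM (T U : eqType) (A : set T) (B : set U) f g S S' :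
  (forall x, 0 <= f x) -> (forall x, 0 <= g x) ->
  sum_bound A f S -> sum_bound B g S' ->
  sum_bound [set p : T * U | A p.1 /\ B p.2] (fun p => f p.1 * g p.2) (S * S').
Proof.
move=> f0 g0 HA HB l ul Hl.
pose l1 := undup (map fst l); pose l2 := undup (map snd l).
apply: (@le_trans _ _ (\sum_(p <- [seq (x, y) | x <- l1, y <- l2]) f p.1 * g p.2)).
  apply: ler_sum_subset => // [p|[x y] xy]; first exact: mulr_ge0.
  by apply: allpairs_f; rewrite mem_undup; apply/mapP; exists (x, y).
rewrite big_allpairs /=.
under eq_bigr => x _ do rewrite -mulr_sumr.
rewrite -mulr_suml; apply: ler_pM.
- exact: sumr_ge0.
- exact: sumr_ge0.
- apply: HA; first exact: undup_uniq.
  by move=> x; rewrite mem_undup => /mapP[p /Hl[+ _] ->].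
- apply: HB; first exact: undup_uniq.
  by move=> x; rewrite mem_undup => /mapP[p /Hl[_ +] ->].
Qed.

Lemma sum_bound_tail (T : eqType) (A : set T) f S e :
  (forall x, 0 <= f x) -> sum_bound A f S -> 0 < e ->
  exists l0 : seq T, sum_bound (A `&` [set x | x \notin l0]) f e.
Proof.
move=> f0 HA e0.
pose V := [set y | exists l, [/\ uniq l, forall x, x \in l -> A x
                      & y = \sum_(x <- l) f x]].
have supV : has_sup V.
  split; first by exists 0, [::]; rewrite big_nil.
  by exists S => _ [l [ul Hl ->]]; exact: HA.
have [_ [l0 [ul0 Hl0 ->]] l0s] := sup_adherent e0 supV.
exists l0 => l ul Hl; have : \sum_(x <- l0 ++ l) f x <= sup V.
  apply: sup_upper_bound => //; exists (l0 ++ l); split=> //.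
    rewrite cat_uniq ul0 ul andbT; apply/hasPn => x /Hl[_]; exact.
  by move=> x; rewrite mem_cat => /orP[/Hl0//|/Hl[]].
by rewrite big_cat /=; lra.
Qed.

(** Each shell of elements with length between [N] and [N + 1] contributes a term
    of a geometric series of ratio [q]. *)
Lemma sum_bound_shells (T : eqType) (A : set T) (len : T -> R) (D v s : R) :
  (forall x, 0 <= len x) -> 0 <= s -> v < s ->
  (forall n : nat, card_bound (A `&` [set x | len x <= n%:R]) (D * expR (v * n%:R))) ->
  exists S, sum_bound A (fun x => expR (- s * len x)) S.
Proof.
move=> len0 s0 vs Hc; pose q := expR (v - s).
have q1 : q < 1 by rewrite expR_lt1; lra.
have q0 : 0 <= q := expR_ge0 _.
have D0 : 0 <= D.
  by have := Hc 0 [::] isT; rewrite /= mulr0 expR0 mulr1; apply.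
pose K := D * expR v / (1 - q).
have K0 : 0 <= K by rewrite divr_ge0 ?mulr_ge0 ?expR_ge0//; lra.
exists K => l ul Hl.
have [N HN] : exists N : nat, forall x, x \in l -> len x < N%:R.
  elim: l {ul Hl} => [|x l [N HN]]; first by exists 0.
  exists (maxn N (Num.trunc (len x)).+1) => y; rewrite inE => /orP[/eqP ->|/HN yN].
    by apply: lt_le_trans (truncnS_gt _) _; rewrite ler_nat leq_maxr.
  by apply: lt_le_trans yN _; rewrite ler_nat leq_maxl.
suff : \sum_(x <- l) expR (- s * len x) <= K * (1 - q ^+ N).
  move=> /le_trans; apply; rewrite ler_piMr// gerBl exprn_ge0//.
elim: N l ul Hl HN => [|N IH] l ul Hl HN.
  case: l ul Hl HN => [|x l] ul Hl HN; first by rewrite big_nil expr0 subrr mulr0.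
  by have := HN x (mem_head _ _); rewrite ltNge len0.
rewrite (bigID (fun x => len x < N%:R)) /=.
have E : K * (1 - q ^+ N.+1) = K * (1 - q ^+ N) + D * expR v * q ^+ N.
  rewrite /K exprS; have : 1 - q != 0 by rewrite subr_eq0 eq_sym lt_eqF.
  by move=> ?; field.
rewrite E; apply: lerD.
  rewrite -big_filter; apply: IH; first exact: filter_uniq.
    by move=> x; rewrite mem_filter => /andP[_ /Hl].
  by move=> x; rewrite mem_filter => /andP[].
rewrite -big_filter; set m := seq.filter _ l.
have Em : (size m)%:R <= D * expR (v * N.+1%:R).
  apply: Hc; first exact: filter_uniq.
  move=> x; rewrite mem_filter => /andP[_ xl]; split; first exact: Hl.
  exact/ltW/HN.
apply: (@le_trans _ _ (\sum_(x <- m) expR (- s * N%:R))).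
  rewrite big_seq [leRHS]big_seq; apply: ler_sum => x.
  rewrite mem_filter -leNgt => /andP[Nx _]; rewrite ler_expR !mulNr lerN2.
  exact: ler_wpM2l.
rewrite big_const_seq count_predT iter_addr_0 -[leLHS]mulr_natl.
apply: (@le_trans _ _ (D * expR (v * N.+1%:R) * expR (- s * N%:R))).
  by apply: ler_wpM2r Em; exact: expR_ge0.
rewrite -!mulrA ler_wpM2l// -expRM_natl -!expRD ler_expR -natr1; lra.
Qed.

Lemma sum_fibers (T U : eqType) (phi : T -> U) (F : U -> R) (l : seq T) (P : seq U) :
  uniq P -> (forall x, x \in l -> phi x \in P) ->
  \sum_(x <- l) F (phi x) =
  \sum_(p <- P) (size [seq x <- l | phi x == p])%:R * F p.
Proof.
move=> uP; elim: l => [|x l IH] Hl.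
  by rewrite big_nil big1_seq// => p _; rewrite mul0r.
rewrite big_cons IH; last by move=> y yl; apply: Hl; rewrite inE yl orbT.
have -> : F (phi x) = \sum_(p <- P) (phi x == p)%:R * F p.
  rewrite (bigD1_seq (phi x)) ?Hl ?mem_head//= eqxx mul1r big1 ?addr0// => p.
  by rewrite eq_sym => /negbTE ->; rewrite mul0r.
rewrite -big_split; apply: eq_bigr => p _ /=; rewrite -mulrDl.
by rewrite -natrD; case: (phi x == p).
Qed.

Lemma size_fibers (T U : eqType) (phi : T -> U) (l : seq T) (P : seq U) :
  uniq P -> (forall x, x \in l -> phi x \in P) ->
  (size l)%:R = \sum_(p <- P) (size [seq x <- l | phi x == p])%:R :> R.
Proof.
move=> uP Hl; have := sum_fibers (fun=> 1) uP Hl.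
rewrite big_const_seq count_predT iter_addr_0 => ->.
by apply: eq_bigr => p _; rewrite mulr1.
Qed.

Lemma bounded_powers (q S : R) : (forall k : nat, q ^+ k <= S) -> q <= 1.
Proof.
move=> H; rewrite leNgt; apply/negP => q1.
have B k : 1 + k%:R * (q - 1) <= q ^+ k.
  elim: k => [|k IH]; first by rewrite mul0r addr0 expr0.
  rewrite exprS -natr1; apply: (@le_trans _ _ (q * (1 + k%:R * (q - 1)))).
    have : 0 <= k%:R * (q - 1) * (q - 1) by rewrite !mulr_ge0//; lra.
    lra.
  by apply: ler_wpM2l => //; lra.
have := H (Num.trunc (S / (q - 1))).+1; have := B (Num.trunc (S / (q - 1))).+1.
have := truncnS_gt (S / (q - 1)); rewrite ltr_pdivrMr; last by lra.
lra.
Qed.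

End FiniteSums.

(** * The Poincare series of barrier-free elements *)

Section WordCounting.
Context {R : realType} {G : groupType} {Y : metricType R}.
Variables (a : isometric_action G Y) (o : Y).
Implicit Types (f g b c u v : G).

Lemma length_mul g f : mdist o (a (g * f)%g o) <= mdist o (a g o) + mdist o (a f o).
Proof.
rewrite actM; have := mdist_triangle (a g o) o (a g (a f o)).
by rewrite act_isometry.
Qed.

Lemma length_word f w : mdist o (a (word f w) o) <=
  \sum_(b <- w) (mdist o (a b o) + mdist o (a f o)).
Proof.
elim: w => [|b w IH]; first by rewrite big_nil /= act1 mdistxx.
rewrite big_cons /=; have := length_mul (b * f)%g (word f w).
by have := length_mul b f; lra.
Qed.

Fixpoint all_words (l : seq G) k : seq (seq G) :=
  if k is k'.+1 then [seq b :: w | b <- l, w <- all_words l k'] else [:: [::]].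

Lemma all_wordsP l k w : w \in all_words l k -> size w = k /\ {subset w <= l}.
Proof.
elim: k w => [|k IH] w /=; first by rewrite inE => /eqP ->.
move=> /allpairsP[[b w'] /= [bl /IH[<- Hw'] ->]]; split=> // x.
by rewrite inE => /orP[/eqP ->|/Hw'].
Qed.

Lemma all_words_uniq l k : uniq l -> uniq (all_words l k).
Proof.
move=> ul; elim: k => //= k IH; apply: allpairs_uniq => //.
by move=> [b w] [b' w'] _ _ /= [-> ->].
Qed.

Lemma sum_all_words (F : G -> R) l k :
  \sum_(w <- all_words l k) \prod_(b <- w) F b = (\sum_(b <- l) F b) ^+ k.
Proof.
elim: k => [|k IH] /=; first by rewrite big_seq1 big_nil expr0.
rewrite big_allpairs_dep exprS -IH mulr_suml; apply: eq_bigr => b _.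
by rewrite mulr_sumr; apply: eq_bigr => w _; rewrite big_cons.
Qed.

Section Multiplicity.
Variables (f : G) (A : set G) (r : R) (M : nat).
Hypothesis ball : card_bound [set g | mdist o (a g o) <= r] (M%:R : R).
Hypothesis first_close : forall b b' w w',
  (forall c, c \in b :: w -> A c) -> (forall c, c \in b' :: w' -> A c) ->
  word f (b :: w) = word f (b' :: w') -> mdist (a b o) (a b' o) <= r.

(** All words with a given value have their first letters in a common ball;
    after removing the first letter the argument repeats. *)
Lemma word_multiplicity k x (W : seq (seq G)) : uniq W ->
  (forall w, w \in W -> [/\ size w = k, forall c, c \in w -> A c & word f w = x]) ->
  (size W)%:R <= M%:R ^+ k :> R.
Proof.
elim: k x W => [|k IH] x W uW HW.
  rewrite expr0 -[1]/(1%:R) ler_nat; apply: (@uniq_leq_size _ W [:: [::]]) => // w.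
  by move=> /HW[/size0nil -> _ _].
have HW' w : w \in W -> w = head 1%g w :: behead w.
  by move=> /HW[]; case: w.
pose P := undup (map (head 1%g) W).
have PM : (size P)%:R <= M%:R :> R.
  have [->|[b0 [P' EP]]] : P = [::] \/ exists b0 P', P = b0 :: P'.
    by case: P => [|b0 P']; [left|right; exists b0, P'].
    exact: ler0n.
  have uP : uniq P by exact: undup_uniq.
  have mP b : b \in P -> exists2 w, w \in W & w = b :: behead w.
    by rewrite mem_undup => /mapP[w wW ->]; exists w => //; exact: HW'.
  have b0P : b0 \in P by rewrite EP mem_head.
  rewrite -(size_map (fun b => b0^-1 * b)%g); apply: ball.
    by rewrite map_inj_uniq //; exact: mulgI.
  move=> _ /mapP[b /mP[w wW Ew] ->] /=; have [w0 w0W Ew0] := mP _ b0P.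
  rewrite actM -act_distl; have [_ A1 E1] := HW _ wW; have [_ A2 E2] := HW _ w0W.
  rewrite Ew in A1 E1; rewrite Ew0 in A2 E2.
  by apply: (first_close A2 A1); rewrite E1 E2.
rewrite (@size_fibers _ _ _ (head 1%g) W P (undup_uniq _)); last first.
  by move=> w wW; rewrite mem_undup map_f.
apply: (@le_trans _ _ (\sum_(p <- P) M%:R ^+ k)); last first.
  rewrite big_const_seq count_predT iter_addr_0 -[leLHS]mulr_natl exprS.
  by apply: ler_wpM2r PM; rewrite exprn_ge0.
apply: ler_sum => b _; set V := [seq w <- W | head 1%g w == b].
have VW w : w \in V -> w \in W /\ w = b :: behead w.
  by rewrite mem_filter => /andP[/eqP <- wW]; split=> //; exact: HW'.
rewrite -(size_map behead); apply: (IH (f^-1 * (b^-1 * x))%g).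
  rewrite map_inj_in_uniq; first exact: filter_uniq.
  by move=> w w' /VW[_ ->] /VW[_ ->] /= ->.
move=> _ /mapP[w /VW[wW Ew] ->]; have [S1 S2 S3] := HW _ wW.
split.
- by rewrite size_behead S1.
- by move=> c cw; apply: S2; rewrite Ew inE cw orbT.
- by rewrite -S3 Ew /= -!mulgA !mulKg.
Qed.

(** The sum over words of length [k] is a [k]-th power, and it is at most [M ^+ k]
    times the series of the group; as [k] grows, the base has to be at most
    [M]. *)
Lemma word_series s S : 0 <= s -> (0 < M)%N ->
  sum_bound [set: G] (fun g => expR (- s * mdist o (a g o))) S ->
  sum_bound A (fun g => expR (- s * mdist o (a g o)))
    (M%:R * expR (s * mdist o (a f o))).
Proof.
move=> s0 M0 HS l ul Hl.
pose F b := expR (- s * (mdist o (a b o) + mdist o (a f o))).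
have M0' : 0 < M%:R :> R by rewrite ltr0n.
suff : (\sum_(b <- l) F b) / M%:R <= 1.
  rewrite ler_pdivrMr // mul1r => H.
  have -> : \sum_(x <- l) expR (- s * mdist o (a x o)) =
      (\sum_(b <- l) F b) * expR (s * mdist o (a f o)).
    rewrite mulr_suml; apply: eq_bigr => b _; rewrite -expRD; congr expR; ring.
  by apply: ler_wpM2r H; exact: expR_ge0.
apply: (@bounded_powers _ _ S) => k.
rewrite expr_div_n ler_pdivrMr ?exprn_gt0// -sum_all_words.
set W := all_words l k; pose P := undup (map (word f) W).
have WP w : w \in W -> word f w \in P by move=> wW; rewrite mem_undup map_f.
apply: (@le_trans _ _ (\sum_(w <- W) expR (- s * mdist o (a (word f w) o)))).
  apply: ler_sum => w _.
  have -> : \prod_(b <- w) F b =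
      expR (- s * \sum_(b <- w) (mdist o (a b o) + mdist o (a f o))).
    elim: w => [|b w IH]; first by rewrite !big_nil mulr0 expR0.
    by rewrite !big_cons IH mulrDr expRD.
  rewrite ler_expR !mulNr lerN2; apply: ler_wpM2l => //; exact: length_word.
rewrite (sum_fibers (fun x => expR (- s * mdist o (a x o))) (undup_uniq _) WP).
apply: (@le_trans _ _ (\sum_(x <- P) M%:R ^+ k * expR (- s * mdist o (a x o)))).
  apply: ler_sum => x _; apply: ler_wpM2r; first exact: expR_ge0.
  apply: (@word_multiplicity _ x); first by rewrite filter_uniq// all_words_uniq.
  move=> w; rewrite mem_filter => /andP[/eqP Ew /all_wordsP[sw wl]]; split=> //.
  by move=> c /wl; exact: Hl.
rewrite -mulr_sumr mulrC; apply: ler_wpM2r; first by rewrite exprn_ge0.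
by apply: HS => //; exact: undup_uniq.
Qed.

End Multiplicity.
End WordCounting.

Section BarrierFreeSeries.
Context {R : realType} {G : groupType} {Y : metricType R}.
Variables (a : isometric_action G Y) (o : Y).
Variables (X : set Y) (E : set G) (C : R).
Hypothesis AX : barrier_axis a o X E C.

(** Outside [E], barrier-free elements are letters of almost free words, so
    [word_series] bounds their series at every [s > w], by a constant that does
    not depend on [s <= w + 1]. On a finite sum, [s] can be taken so close to [w]
    that passing to [w] costs a factor [expR 1]. The barrier-free elements of [E]
    have bounded length. *)
Lemma barrier_free_series K w : proper_space Y -> proper_action a -> 0 <= K ->
  0 <= w ->
  (forall s, w < s ->
     exists S, sum_bound [set: G] (fun g => expR (- s * mdist o (a g o))) S) ->
  exists S, sum_bound (barrier_free a o X K) (fun g => expR (- w * mdist o (a g o))) S.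
Proof.
move=> PY Pa K0 w0 Hw; have C1 := axis_ge1 AX.
have [f fX fbig] := axis_unbounded AX (10 * C + 10 * K).
pose A : set G := [set b | barrier_free a o X K b /\ ~ E b].
have [M0 HM0] := @finite_card_bound R _ _ (finite_orbit_ball o o (2 * K + 5 * C) PY Pa).
pose M := M0.+1.
have HM : card_bound [set g | mdist o (a g o) <= 2 * K + 5 * C] (M%:R : R).
  by move=> l ul Hl; apply: le_trans (HM0 l ul Hl) _; rewrite ler_nat.
have close b b' v v' : (forall c, c \in b :: v -> A c) ->
    (forall c, c \in b' :: v' -> A c) ->
    word f (b :: v) = word f (b' :: v') ->
    mdist (a b o) (a b' o) <= 2 * K + 5 * C.
  by move=> H1 H2 H3; apply: (word_first_close AX K0 fX fbig H1 H2 H3).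
pose S1 := M%:R * expR ((w + 1) * mdist o (a f o)).
have HA s : w < s -> s <= w + 1 ->
    sum_bound A (fun g => expR (- s * mdist o (a g o))) S1.
  move=> ws sw1 l ul Hl; have [S HS] := Hw s ws.
  have s0 : 0 <= s by lra.
  have HB := word_series HM close s0 (ltn0Sn M0) HS.
  apply: le_trans (HB l ul Hl) _.
  apply: ler_wpM2l => //; rewrite ler_expR; apply: ler_wpM2r => //.
  exact: mdist_ge0.
have HAw : sum_bound A (fun g => expR (- w * mdist o (a g o))) (expR 1 * S1).
  move=> l ul Hl.
  have [T T0 HT] : exists2 T : R, 1 <= T & forall x, x \in l -> mdist o (a x o) <= T.
    elim: l {ul Hl} => [|x l [T T0 HT]]; first by exists 1.
    exists (T + mdist o (a x o)); first by have := mdist_ge0 o (a x o); lra.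
    move=> y; rewrite inE => /orP[/eqP ->|/HT]; first lra.
    by have := mdist_ge0 o (a x o); lra.
  have TV : T^-1 <= 1 by rewrite invf_le1; lra.
  have TV0 : 0 < T^-1 by rewrite invr_gt0; lra.
  have := HA (w + T^-1) _ _ l ul Hl.
  have -> : w < w + T^-1 by lra.
  have -> : w + T^-1 <= w + 1 by lra.
  move=> /(_ isT isT) /(ler_wpM2l (expR_ge0 1)); apply: le_trans.
  rewrite mulr_sumr big_seq [leRHS]big_seq; apply: ler_sum => x /HT xT.
  rewrite -expRD ler_expR.
  have : T^-1 * mdist o (a x o) <= 1 by rewrite mulrC ler_pdivrMr; lra.
  by rewrite !mulNr mulrDl; lra.
have [N HN] := @finite_card_bound R _ _ (finite_orbit_ball o o (K + C) PY Pa).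
exists (expR 1 * S1 + N%:R) => l ul Hl.
rewrite (bigID (fun b => `[< E b >])) /= addrC; apply: lerD.
  rewrite -big_filter; apply: HAw; first exact: filter_uniq.
  by move=> x; rewrite mem_filter => /andP[/asboolP nE xl]; split=> //; exact: Hl.
rewrite -big_filter; set m := seq.filter _ l.
apply: (@le_trans _ _ (\sum_(x <- m) 1)).
  apply: ler_sum => x _; rewrite -expR0 ler_expR mulNr oppr_le0 mulr_ge0//.
  exact: mdist_ge0.
rewrite big_const_seq count_predT iter_addr_0; apply: HN; first exact: filter_uniq.
move=> x; rewrite mem_filter => /andP[/asboolP Ex xl] /=.
have [q Hq] := axis_proximinal AX (a x o).
have oq := barrier_free_start AX (Hl x xl) Hq.
have [y gy oy] := axis_close AX (axis_inv AX Ex) (axis_base AX).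
have Xxy : X (a x y) by move: gy; rewrite /translate /= invgK.
have := Hq.2 _ Xxy; rewrite act_isometry.
by have := mdist_triangle q o (a x o); have := mdist_sym q (a x o); lra.
Qed.

End BarrierFreeSeries.

(** * The recursion along geodesics *)

Section ConvexCocompactRecursion.
Context {R : realType} {G : groupType} {Y : metricType R}.
Variables (a : isometric_action G Y) (o : Y) (M1 M2 : R).
Implicit Types (g u v b c : G) (B : set G) (gamma : R -> Y).

Local Notation len g := (mdist o (a g o)).

(** Geodesics of length at most [r] from near [o] to near [g o] such that all
    subsegments with ends near the orbit are given by elements of [B]. Unlike a
    condition on [g] alone, this one is inherited by the end of the geodesic after
    a step of the recursion. *)
Definition in_thick B r g : Prop := exists L gamma, [/\ L <= r,
  is_geodesic L gamma, mdist (gamma 0) o <= M1, mdist (gamma L) (a g o) <= M1 &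
  forall s s' u v, 0 <= s -> s <= s' -> s' <= L ->
    mdist (gamma s) (a u o) <= M1 -> mdist (gamma s') (a v o) <= M1 ->
    B (u^-1 * v)%g].

Definition step_pairs B T : set (G * G) := [set p |
  [/\ B p.1, concave_region a o M1 M2 p.2, len p.1 <= T + 2 * M1 &
      T - 4 * M1 <= len p.1 + len p.2]].

Lemma geodesic_act g L gamma :
  is_geodesic L gamma -> is_geodesic L (fun t => a g (gamma t)).
Proof.
by move=> [L0 H]; split=> // s t sL tL; rewrite act_isometry; exact: H.
Qed.

(** Greedy step: walk up to time [T], step back to the last time [p] near the
    orbit and forward to the next one [q]; the gap in between is an element of the
    concave region, the trivial gap included. *)
Lemma thick_step B T r g : proper_space Y -> proper_action a ->
  0 <= M1 -> M1 <= M2 -> 0 <= T -> in_thick B r g -> T + 2 * M1 < len g ->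
  exists p, step_pairs B T p /\
    in_thick B (r - Num.max T (len p.1 + len p.2 - 4 * M1)) ((p.1 * p.2)^-1 * g)%g.
Proof.
move=> PY Pa M10 M12 T0 [L [gamma [Lr Hg g0 gL HB]]] gbig.
have L0 := geodesic_ge0 Hg.
have DL := geodesic_dist Hg (lexx 0) L0 (lexx L).
have TL : T <= L.
  have := mdist_triangle (gamma 0) o (a g o).
  have := mdist_triangle (gamma L) (gamma 0) (a g o).
  have := mdist_sym o (gamma 0); lra.
pose good t := exists u, mdist (gamma t) (a u o) <= M1.
have good0 : good 0 by exists 1%g; rewrite act1.
have goodL : good L by exists g.
have attain y : (forall e : R, 0 < e -> exists u, mdist y (a u o) <= M1 + e) ->
    exists u, mdist y (a u o) <= M1.
  move=> H; have [|u _ Hu] := @orbit_attain _ _ _ a y o [set: G] M1 PY Pa.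
    by move=> e /H[u Hu]; exists u.
  by exists u.
have near s t e u : 0 <= s -> s <= L -> 0 <= t -> t <= L -> `|s - t| <= e ->
    mdist (gamma s) (a u o) <= M1 -> mdist (gamma t) (a u o) <= M1 + e.
  move=> s0 sL t0 tL st su; have E1 : mdist (gamma t) (gamma s) = `|t - s|.
    by apply: Hg.2; rewrite in_itv /= ?s0 ?t0.
  have := mdist_triangle (gamma s) (gamma t) (a u o).
  by rewrite distrC in st; lra.
pose S1 := [set t | [/\ 0 <= t, t <= T & good t]].
pose S2 := [set t | [/\ T <= t, t <= L & good t]].
have supS1 : has_sup S1 by split; [exists 0|exists T => t []].
have infS2 : has_inf S2 by split; [exists L|exists T => t []].
pose p := sup S1; pose q := inf S2.
have S1p t : S1 t -> t <= p by move=> St; apply: sup_upper_bound.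
have S2q t : S2 t -> q <= t by move=> St; apply: ge_inf => //; case: infS2.
have p0 : 0 <= p by apply: S1p.
have pT : p <= T by apply: ge_sup; [case: supS1|move=> t []].
have qL : q <= L by apply: S2q.
have Tq : T <= q by apply: lb_le_inf; [case: infS2|move=> t []].
have [u Hu] : good p.
  apply: attain => e e0; have [t [t0 tT [u tu]] pt] := sup_adherent e0 supS1.
  exists u; apply: (near t) => //; try lra.
  have := S1p t; rewrite -/p in pt; move=> /(_ (And3 t0 tT (ex_intro _ u tu))) tp.
  by rewrite ler0_norm; lra.
have [v Hv] : good q.
  apply: attain => e e0; have [t [tT tL [v tv]] qt] := inf_adherent e0 infS2.
  exists v; apply: (near t) => //; try lra.
  have := S2q t; rewrite -/q in qt; move=> /(_ (And3 tT tL (ex_intro _ v tv))) tq.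
  by rewrite ger0_norm; lra.
have q0 : 0 <= q by lra.
have pq : p <= q by lra.
have Dp := geodesic_dist Hg (lexx 0) p0 (le_trans pq qL).
have Dpq := geodesic_dist Hg p0 pq qL.
have len1 : len u <= p + 2 * M1 /\ p - 2 * M1 <= len u.
  have := mdist_triangle (gamma 0) o (a u o); have := mdist_triangle (gamma p) (gamma 0) (a u o).
  have := mdist_triangle o (gamma 0) (gamma p); have := mdist_triangle (a u o) o (gamma p).
  have := mdist_sym o (gamma 0); have := mdist_sym (a u o) (gamma p); lra.
have Evu : len (u^-1 * v)%g = mdist (a u o) (a v o).
  by rewrite actM -act_distl.
have len2 : len (u^-1 * v)%g <= q - p + 2 * M1 /\ q - p - 2 * M1 <= len (u^-1 * v)%g.
  rewrite Evu.
  have := mdist_triangle (gamma p) (a u o) (a v o).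
  have := mdist_triangle (gamma q) (gamma p) (a v o).
  have := mdist_triangle (a u o) (gamma p) (gamma q).
  have := mdist_triangle (a v o) (a u o) (gamma q).
  have := mdist_sym (a u o) (gamma p); have := mdist_sym (a v o) (gamma q); lra.
exists (u, (u^-1 * v)%g); split.
  split=> /=.
  - have := HB 0 p 1%g u (lexx 0) p0 (le_trans pq qL); rewrite invg1 mul1g.
    by apply=> //; rewrite act1.
  - exists (q - p), (fun t => a u^-1%g (gamma (p + t))); split.
    + by apply: (@geodesic_act _ _ (fun t => gamma (p + t))); exact: (geodesic_sub Hg p0 pq qL).
    + by rewrite /cball /= addr0 act_distr invgK mdist_sym; lra.
    + rewrite /cball /= (_ : p + (q - p) = q); last by ring.
      by rewrite actM act_isometry mdist_sym; lra.
    + apply/seteqP; split=> // z [[t + <-]]; rewrite /= in_itv /= => /andP[t0 tqp] Hz.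
      have [w Hw] : good (p + t).
        apply: attain => e e0.
        have M1e : (M1%:E < (M1 + e)%:E)%E by rewrite lte_fin; lra.
        have [_ [_ -> [_ [w _ <-] <-]]] := ereal_inf_lt (le_lt_trans Hz M1e).
        rewrite lte_fin => Hw; exists (u * w)%g; rewrite actM act_distr.
        exact: ltW.
      case: (lerP (p + t) T) => ptT.
        have /S1p : S1 (p + t) by split; [lra|lra|exists w].
        by lra.
      have /S2q : S2 (p + t) by split; [lra|lra|exists w].
      by lra.
  - by case: len1; lra.
  - by case: len1; case: len2; lra.
exists (L - q), (fun t => a v^-1%g (gamma (q + t))); split=> /=.
- have : Num.max T (len u + len (u^-1 * v)%g - 4 * M1) <= q.
    by rewrite ge_max Tq /=; case: len1; case: len2; lra.
  by lra.
- by apply: (@geodesic_act _ _ (fun t => gamma (q + t))); exact: (geodesic_sub Hg q0 qL (lexx L)).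
- by rewrite addr0 act_distl invgK.
- rewrite (_ : q + (L - q) = L); last by ring.
  by rewrite mulVKg actM act_isometry.
- move=> s s' u' v' s0 ss' s'L; rewrite !act_distl !invgK -!actM => H1 H2.
  have := HB (q + s) (q + s') (v * u')%g (v * v')%g _ _ _ H1 H2.
  rewrite invgM -mulgA mulKg; apply; lra.
Qed.

(** Removing the first pair maps the elements with given pair injectively to
    elements of smaller length, and the total weight of the pairs is at most 1/2;
    the factor 2 in the constant absorbs the elements that are too short for a
    step. The induction runs over an integer bound on [r], as each step shortens
    the geodesic by at least [T >= 1]. *)
Lemma thick_count B T s : proper_space Y -> proper_action a ->
  0 <= M1 -> M1 <= M2 -> 1 <= T -> 0 <= s ->
  sum_bound (step_pairs B T)
    (fun p => expR (- s * (len p.1 + len p.2 - 4 * M1))) (1 / 2) ->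
  exists2 D, 0 <= D & forall r, card_bound (in_thick B r) (D * expR (s * r)).
Proof.
move=> PY Pa M10 M12 T1 s0 HP.
have [N HN] := @finite_card_bound R _ _ (finite_orbit_ball o o (T + 2 * M1) PY Pa).
exists (2 * N%:R); first by rewrite mulr_ge0.
move=> r; have [k rk] : exists k : nat, r < k%:R by exists (Num.trunc r).+1; exact: truncnS_gt.
elim: k r rk => [|k IH] r rk l ul Hl.
  case: l ul Hl => [|x l] ul Hl; first by rewrite !mulr_ge0// expR_ge0.
  have [L [gamma [Lr [L0 _] _ _ _]]] := Hl x (mem_head _ _).
  by move: rk; rewrite mulr0n; lra.
have [r0|r0] := ltP r 0.
  case: l ul Hl => [|x l] ul Hl; first by rewrite !mulr_ge0// expR_ge0.
  have [L [gamma [Lr [L0 _] _ _ _]]] := Hl x (mem_head _ _); lra.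
pose short g := len g <= T + 2 * M1.
rewrite -(count_predC short l) natrD.
have A1 : (count short l)%:R <= N%:R * expR (s * r).
  apply: (@le_trans _ _ N%:R).
    rewrite -size_filter; apply: HN; first exact: filter_uniq.
    by move=> x; rewrite mem_filter => /andP[].
  by rewrite ler_peMr// -expR0 ler_expR mulr_ge0.
suff A2 : (count (predC short) l)%:R <= N%:R * expR (s * r).
  by rewrite -mulrA mulr_natl mulr2n; exact: lerD.
rewrite -size_filter; set m := seq.filter _ l.
have : forall g, exists p, g \in m -> step_pairs B T p /\
    in_thick B (r - Num.max T (len p.1 + len p.2 - 4 * M1)) ((p.1 * p.2)^-1 * g)%g.
  move=> g; case: (boolP (g \in m)); last by exists (1%g, 1%g).
  rewrite mem_filter /= -ltNge => /andP[gbig /Hl gl].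
  have [|p Hp] := thick_step PY Pa M10 M12 _ gl gbig; first by lra.
  by exists p.
move=> /choice[phi Hphi].
pose P := undup (map phi m).
have mP x : x \in m -> phi x \in P by move=> xm; rewrite mem_undup map_f.
rewrite (@size_fibers _ _ _ phi m P (undup_uniq _) mP).
pose F (p : G * G) := expR (- s * (len p.1 + len p.2 - 4 * M1)).
apply: (@le_trans _ _ (\sum_(p <- P) 2 * N%:R * expR (s * r) * F p)).
  apply: ler_sum => p _; set m' := [seq _ <- _ | _].
  rewrite -(size_map (fun g => (p.1 * p.2)^-1 * g)%g).
  set d := Num.max T (len p.1 + len p.2 - 4 * M1).
  have dT : T <= d by rewrite le_max lexx.
  have dp : len p.1 + len p.2 - 4 * M1 <= d by rewrite le_max lexx orbT.
  apply: (@le_trans _ _ (2 * N%:R * expR (s * (r - d)))).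
    apply: IH; first by move: rk; rewrite -natr1; lra.
      by rewrite map_inj_uniq ?filter_uniq//; exact: mulgI.
    move=> _ /mapP[g + ->]; rewrite mem_filter => /andP[/eqP Ep gm].
    by have [_] := Hphi g gm; rewrite Ep.
  rewrite -[leRHS]mulrA; apply: ler_wpM2l; first by rewrite mulr_ge0.
  rewrite /F -expRD ler_expR mulrBr mulNr.
  by have := ler_wpM2l s0 dp; lra.
rewrite -mulr_sumr.
have : \sum_(p <- P) F p <= 1 / 2.
  apply: HP; first exact: undup_uniq.
  by move=> p; rewrite mem_undup => /mapP[g /Hphi[+ _] ->].
move=> /(ler_wpM2l (_ : 0 <= 2 * N%:R * expR (s * r))) => /(_ _).
have -> : 0 <= 2 * N%:R * expR (s * r) by rewrite !mulr_ge0// expR_ge0.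
by move=> /(_ isT); lra.
Qed.

End ConvexCocompactRecursion.

(** * Growth rates and cardinality bounds *)

Section Growth.
Context {R : realType}.

Lemma counting_nonneg (T : choiceType) (A : set T) : (0 <= counting A :> \bar R)%E.
Proof. by rewrite /counting; case: ifPn => _; [rewrite lee_fin|exact: leey]. Qed.

Lemma card_bound_counting (T : choiceType) (A : set T) (r : R) :
  card_bound A r -> (counting A <= r%:E)%E.
Proof.
move=> HA; have fA : finite_set A.
  apply: contrapT => infA.
  have [B BA nB] := infinite_set_fset (Num.trunc r).+1 infA.
  have := HA (enum_fset B) (fset_uniq B) (fun x xB => BA x xB).
  have := truncnS_gt r; rewrite leNgt => rn /negP; apply; apply: lt_le_trans rn _.
  by rewrite ler_nat.
rewrite /counting asboolT// lee_fin; apply: HA; first exact: fset_uniq.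
by move=> x; rewrite in_fset_set// => /set_mem.
Qed.

Lemma counting_card_bound (T : choiceType) (A : set T) (r : R) :
  (counting A <= r%:E)%E -> card_bound A r.
Proof.
rewrite /counting; case: ifPn => [/asboolP fA|_]; last by rewrite leye_eq.
rewrite lee_fin => Ar l ul Hl; apply: le_trans Ar; rewrite ler_nat.
apply: uniq_leq_size => // x /Hl Ax.
by rewrite in_fset_set//; exact: mem_set.
Qed.

Lemma growth_lt_card (T : choiceType) (A : nat -> set T) (v : R) : 0 <= v ->
  (forall m n, (m <= n)%N -> A m `<=` A n) ->
  (growth A < v%:E)%E ->
  exists2 D, 0 <= D & forall n, card_bound (A n) (D * expR (v * n%:R)).
Proof.
move=> v0 Amono; rewrite /growth /limn_esup /limf_esup.
move=> /ereal_inf_lt[_ [B [N _ NB] <-] supB].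
have big n : (N <= n)%N -> (0 < n)%N -> card_bound (A n) (expR (v * n%:R)).
  move=> Nn n0; apply: counting_card_bound.
  have : (lne (counting (A n)) * (n%:R^-1)%:E < v%:E)%E.
    apply: le_lt_trans supB; apply: ereal_sup_ubound.
    by exists n => //; exact: NB.
  have n0' : 0 < n%:R :> R by rewrite ltr0n.
  case: (counting (A n)) (counting_nonneg (A n)) => [r r0| |//].
    rewrite lee_fin; have [->|rn0] := eqVneq r 0; first by rewrite expR_ge0.
    have rp : 0 < r by rewrite lt_neqAle eq_sym rn0 -lee_fin.
    rewrite lne_EFin// -EFinM lte_fin ltr_pdivrMr// => H.
    by rewrite -[r]lnK ?posrE// ler_expR ltW.
  by rewrite /lne/= gt0_mulye// lte_fin invr_gt0.
exists (expR (v * N.+1%:R)); first exact: expR_ge0.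
move=> n l ul Hl; case: (leqP N.+1 n) => Nn.
  apply: le_trans (big n (ltnW Nn) (leq_trans (ltn0Sn N) Nn) l ul Hl) _.
  by rewrite ler_peMl ?expR_ge0// -expR0 ler_expR mulr_ge0.
apply: le_trans (big N.+1 (leqnSn N) (ltn0Sn N) l ul _) _.
  by move=> x /Hl; apply: Amono; exact: ltnW.
by rewrite ler_peMr ?expR_ge0// -expR0 ler_expR mulr_ge0.
Qed.

Lemma card_growth_le (T : choiceType) (A : nat -> set T) (D s s' : R) : s < s' ->
  (forall n, card_bound (A n) (D * expR (s * n%:R))) -> (growth A <= s'%:E)%E.
Proof.
move=> ss' HA.
pose D' := Num.max D 1; have D'0 : 0 < D' by rewrite lt_max ltr01 orbT.
pose N := (Num.trunc (ln D' / (s' - s))).+1.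
rewrite /growth /limn_esup /limf_esup.
apply: ge_ereal_inf; exists (ereal_sup
  [set (lne (counting (A n)) * (n%:R^-1)%:E)%E | n in [set n | (N <= n)%N]]).
  by exists [set n | (N <= n)%N] => //; exists N.
apply: ge_ereal_sup => _ [n Nn <-].
have n0 : 0 < n%:R :> R by rewrite ltr0n; apply: leq_trans Nn.
have cA : (counting (A n) <= (D' * expR (s * n%:R))%:E)%E.
  apply: le_trans (card_bound_counting (HA n)) _; rewrite lee_fin ler_wpM2r ?expR_ge0//.
  by rewrite le_max lexx.
apply: (@le_trans _ _ ((ln (D' * expR (s * n%:R)))%:E * (n%:R^-1)%:E)%E).
  apply: lee_wpmul2r; first by rewrite lee_fin invr_ge0 ltW.
  rewrite -lne_EFin ?mulr_gt0 ?expR_gt0// lee_lne// in_itv/= leey andbT.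
    exact: counting_nonneg.
  by rewrite lee_fin mulr_ge0 ?expR_ge0// ltW.
rewrite -EFinM lee_fin ler_pdivrMr// lnM ?posrE ?expR_gt0// expRK.
have A1 : ln D' / (s' - s) <= n%:R.
  by apply: ltW; apply: lt_le_trans (truncnS_gt _) _; rewrite ler_nat.
by rewrite ler_pdivrMr in A1; lra.
Qed.

Lemma growth_ge0 (T : choiceType) (A : nat -> set T) x : (forall n, A n x) ->
  (0 <= growth A :> \bar R)%E.
Proof.
move=> Ax; rewrite /growth /limn_esup /limf_esup.
apply: le_ereal_inf_tmp => _ [B [N _ NB] <-].
apply: le_ereal_sup_tmp; exists (lne (counting (A N)) * (N%:R^-1)%:E)%E.
  by exists N => //; apply: NB => /=.
apply: mule_ge0; last by rewrite lee_fin invr_ge0.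
rewrite lne_ge0 /counting; case: ifPn => [/asboolP fA|_]; last exact: leey.
rewrite lee_fin -[leLHS]/(1%:R) ler_nat cardfs_gt0; apply/fset0Pn; exists x.
by rewrite in_fset_set//; apply/mem_set; exact: Ax.
Qed.

End Growth.

(** * Growth tightness and conjugacy classes *)

Section Entropy.
Context {R : realType} {G : groupType} {Y : metricType R}.
Variables (a : isometric_action G Y) (o : Y) (M1 M2 : R).
Implicit Types (g u v b c : G) (B : set G).

Local Notation len g := (mdist o (a g o)).
Local Notation concave := (concave_region a o M1 M2).

Lemma concave1 : 0 <= M2 -> concave 1%g.
Proof.
move=> M20; exists 0, (fun=> o); split.
- split=> // s t; rewrite !in_itv /= => s0 t0.
  by rewrite mdistxx (_ : s = t) ?subrr ?normr0//; lra.
- by rewrite /cball /= mdistxx.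
- by rewrite /cball /= act1 mdistxx.
- apply/seteqP; split=> // z [[t + _] _]; rewrite /= in_itv /= => /andP[]; lra.
Qed.

Lemma growth_card_series (A : set G) (v s : R) : 0 <= v -> v < s ->
  (omega a o A < v%:E)%E ->
  exists S, sum_bound A (fun g => expR (- s * len g)) S.
Proof.
move=> v0 vs Av.
have [D D0 HD] : exists2 D, 0 <= D &
    forall n, card_bound (orbit_ball a o n `&` A) (D * expR (v * n%:R)).
  apply: growth_lt_card Av => // m n mn g [gm Ag]; split=> //.
  by apply: le_trans gm _; rewrite ler_nat.
apply: (@sum_bound_shells _ _ A (fun g => len g) D v s) => //.
- by move=> g; exact: mdist_ge0.
- by lra.
- by move=> n; rewrite setIC; exact: HD.
Qed.

Lemma ball_thick B (n : nat) (P : set G) : geodesic_space Y -> 0 <= M1 ->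
  (forall g L gamma s s' u v, P g -> is_geodesic L gamma -> gamma 0 = o ->
    gamma L = a g o -> 0 <= s -> s <= s' -> s' <= L ->
    mdist (gamma s) (a u o) <= M1 -> mdist (gamma s') (a v o) <= M1 ->
    B (u^-1 * v)%g) ->
  orbit_ball a o n `&` P `<=` in_thick a o M1 B n%:R.
Proof.
move=> HY M10 HB g [gn Pg].
have [L [gamma [Hg g0 gL]]] := HY o (a g o).
exists L, gamma; split=> //.
- have := geodesic_dist Hg (lexx 0) (geodesic_ge0 Hg) (lexx L).
  by rewrite g0 gL subr0 => <-.
- by rewrite g0 mdistxx.
- by rewrite gL mdistxx.
- by move=> s s' u v; exact: (HB g L gamma s s' u v Pg Hg g0 gL).
Qed.

(** With [T = 1 + 8 M1], the length that enters the weight of a pair is at least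
    1, so that increasing the exponent makes the total weight arbitrarily small,
    without any restriction on the pieces near the orbit. *)
Lemma omega_finite : proper_space Y -> geodesic_space Y -> proper_action a ->
  0 <= M1 -> M1 <= M2 -> (omega a o concave < omega a o [set: G])%E ->
  (omega a o [set: G] < +oo)%E.
Proof.
move=> PY HY Pa M10 M12 gap.
have [v v0 Ov] : exists2 v : R, 0 <= v & (omega a o concave < v%:E)%E.
  case: (omega a o concave) gap => [r _| |_].
  - exists (`|r| + 1); first by have := normr_ge0 r; lra.
    by rewrite lte_fin; have := ler_norm r; lra.
  - by rewrite ltNge leey.
  - by exists 0; rewrite ?ltNyr.
pose s1 := v + 1; have s10 : 0 <= s1 by rewrite /s1; lra.
have [S HS] : exists S, sum_bound concave (fun g => expR (- s1 * len g)) S.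
  by apply: (growth_card_series v0 _ Ov); rewrite /s1; lra.
pose T := 1 + 8 * M1.
have [N HN] := @finite_card_bound R _ _ (finite_orbit_ball o o (T + 2 * M1) PY Pa).
have HB : sum_bound [set g | len g <= T + 2 * M1] (fun g => expR (- s1 * len g)) N%:R.
  move=> l ul Hl; apply: le_trans (HN l ul Hl).
  apply: (@le_trans _ _ (\sum_(x <- l) 1)).
    apply: ler_sum => x _; rewrite -expR0 ler_expR mulNr oppr_le0 mulr_ge0//.
    exact: mdist_ge0.
  by rewrite big_const_seq count_predT iter_addr_0.
have HP := sum_boundM (fun x => expR_ge0 _) (fun x => expR_ge0 _) HB HS.
have S0 := sum_bound_ge0 HP.
pose Q := expR (4 * s1 * M1) * (N%:R * S).
have Q0 : 0 <= Q by rewrite /Q mulr_ge0 ?expR_ge0.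
pose t := 2 * Q.
have T1 : 1 <= T by rewrite /T; lra.
have s1t : 0 <= s1 + t by rewrite /t; lra.
have HS' : sum_bound (step_pairs a o M1 M2 setT T)
    (fun p => expR (- (s1 + t) * (len p.1 + len p.2 - 4 * M1))) (1 / 2).
  move=> l ul Hl.
  apply: (@le_trans _ _ (\sum_(p <- l) expR (- t) * expR (4 * s1 * M1) *
      (expR (- s1 * len p.1) * expR (- s1 * len p.2)))).
    rewrite big_seq [leRHS]big_seq; apply: ler_sum => p /Hl[_ _ _ pT].
    rewrite -!expRD ler_expR.
    have : t <= t * (len p.1 + len p.2 - 4 * M1).
      by rewrite ler_peMr //; [rewrite /t; lra|rewrite /T in pT; lra].
    lra.
  rewrite -mulr_sumr.
  have : \sum_(p <- l) expR (- s1 * len p.1) * expR (- s1 * len p.2) <= N%:R * S.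
    by apply: HP => // p /Hl[].
  move=> /(ler_wpM2l (mulr_ge0 (expR_ge0 (- t)) (expR_ge0 (4 * s1 * M1)))).
  move=> /le_trans; apply.
  rewrite -mulrA -/Q expRN mulrC ler_pdivrMr ?expR_gt0//.
  have : 1 + t <= expR t by apply: expR_ge1Dx; rewrite /t; lra.
  by rewrite /t; lra.
have [D D0 HD] := thick_count PY Pa M10 M12 T1 s1t HS'.
apply: (@le_lt_trans _ _ (s1 + t + 1)%:E); last exact: ltry.
apply: (@card_growth_le _ _ _ D (s1 + t)); first by lra.
move=> n l ul Hl; apply: HD => // x /Hl.
by apply: ball_thick => // *.
Qed.

Lemma expR_half : expR (1 / 2) <= 2 :> R.
Proof.
have : 1 + - (1 / 2) <= expR (- (1 / 2)) :> R by apply: expR_ge1Dx; lra.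
have : expR (- (1 / 2)) * expR (1 / 2) = 1 :> R by rewrite -expRD addNr expR0.
have := expR_gt0 (1 / 2 : R); nra.
Qed.

(** The time step [T] is chosen so that all pairs of large weight are too short to
    be steps; only afterwards is the exponent decreased by [d]. This multiplies
    the weight of the barrier-free part, whose length is at most [T + 2 M1], by at
    most [expR (d * (T + 2 * M1))], and the concave part is weighted from the
    start with the smaller exponent [s0]. *)
Lemma barrier_free_growth X E C K w s0 : barrier_axis a o X E C ->
  proper_space Y -> geodesic_space Y -> proper_action a ->
  0 <= M1 -> M1 <= M2 -> 0 <= K -> 0 <= s0 -> s0 < w ->
  (forall s, w < s -> exists S, sum_bound [set: G] (fun g => expR (- s * len g)) S) ->
  (exists S, sum_bound concave (fun g => expR (- s0 * len g)) S) ->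
  exists s D, [/\ s0 <= s, s < w, 0 <= D & forall n : nat,
    card_bound (orbit_ball a o n `&` barrier_free a o X K) (D * expR (s * n%:R))].
Proof.
move=> AX PY HY Pa M10 M12 K0 s00 s0w Hw [SO HSO].
have C1 := axis_ge1 AX.
pose K' := K + 2 * M1 + 6 * C; have K'0 : 0 <= K' by rewrite /K'; lra.
have w0 : 0 <= w by lra.
have [SB HSB] := barrier_free_series AX PY Pa K'0 w0 Hw.
have HP := sum_boundM (fun x => expR_ge0 _) (fun x => expR_ge0 _) HSB HSO.
(* The first factor cancels the term [4 * M1] in the weights, and the second
   compensates for the factor 2 lost in decreasing the exponent. *)
pose e := expR (- (4 * w * M1)) / 4.
have e0 : 0 < e by rewrite divr_gt0 ?expR_gt0.
have [|l0 Hl0] := sum_bound_tail _ HP e0; first by move=> p; rewrite mulr_ge0 ?expR_ge0.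
have [T T1 HT] : exists2 T, 1 <= T &
    forall p, p \in l0 -> len p.1 + len p.2 < T - 4 * M1.
  elim: l0 {Hl0} => [|p l [T T1 HT]]; first by exists 1.
  have := mdist_ge0 o (a p.1 o); have := mdist_ge0 o (a p.2 o) => P1 P2.
  exists (T + len p.1 + len p.2 + 4 * M1); first by lra.
  by move=> q; rewrite inE => /orP[/eqP ->|/HT]; lra.
have TM : 0 < 2 * (T + 2 * M1) by lra.
pose d := Num.min (w - s0) (2 * (T + 2 * M1))^-1.
have d0 : 0 < d by rewrite lt_min subr_gt0 s0w invr_gt0.
have dw : d <= w - s0 by rewrite ge_min lexx.
have dT : d * (T + 2 * M1) <= 1 / 2.
  have : d <= (2 * (T + 2 * M1))^-1 by rewrite ge_min lexx orbT.
  by rewrite -[X in _ <= X]mul1r ler_pdivlMr //; lra.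
have wd : 0 <= w - d by lra.
have HS' : sum_bound (step_pairs a o M1 M2 (barrier_free a o X K') T)
    (fun p => expR (- (w - d) * (len p.1 + len p.2 - 4 * M1))) (1 / 2).
  move=> l ul Hl.
  apply: (@le_trans _ _ (\sum_(p <- l) expR (4 * w * M1) * 2 *
      (expR (- w * len p.1) * expR (- s0 * len p.2)))).
    rewrite big_seq [leRHS]big_seq; apply: ler_sum => p /Hl[_ _ pT _].
    apply: (@le_trans _ _ (expR (4 * w * M1) * expR (1 / 2) *
      (expR (- w * len p.1) * expR (- s0 * len p.2)))); last first.
      rewrite ler_wpM2r ?mulr_ge0 ?expR_ge0// ler_wpM2l ?expR_ge0//.
      exact: expR_half.
    rewrite -!expRD ler_expR.
    have : d * len p.1 <= d * (T + 2 * M1) by rewrite ler_wpM2l// ltW.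
    have : 0 <= (w - s0 - d) * len p.2 by rewrite mulr_ge0 ?mdist_ge0//; lra.
    have : 0 <= d * M1 by rewrite mulr_ge0// ltW.
    lra.
  rewrite -mulr_sumr.
  have : \sum_(p <- l) expR (- w * len p.1) * expR (- s0 * len p.2) <= e.
    apply: Hl0 => // p /Hl[Bp Op _ pT]; split=> //=.
    by apply/negP => /HT; lra.
  have E0 : 0 <= expR (4 * w * M1) * 2 by rewrite mulr_ge0 ?expR_ge0.
  move=> /(ler_wpM2l E0) /le_trans; apply.
  have : expR (4 * w * M1) * expR (- (4 * w * M1)) = 1 :> R.
    by rewrite -expRD subrr expR0.
  by rewrite /e; lra.
have [D D0 HD] := thick_count PY Pa M10 M12 T1 wd HS'.
exists (w - d), D; split=> //; [lra|lra|].
move=> n l ul Hl; apply: HD => // x /Hl.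
apply: ball_thick => // g L gamma s s' u v Bg Hg g0 gL s0' ss' s'L us vs.
exact: (barrier_free_sub AX M10 Bg Hg g0 gL s0' ss' s'L us vs).
Qed.

Lemma shortest_in_class g : proper_space Y -> proper_action a ->
  exists2 x, shortest a o (g ^ x)%g &
    mdist o (a (g ^ x)%g o) <= conj_length a o (conj_class g).
Proof.
move=> PY Pa.
have [|_ [x _ <-] Hx] := orbit_min (P := conj_class g) o o PY Pa.
  by exists (g ^ 1)%g; exists 1%g.
exists x; first by move=> f; apply: Hx; exists (x * f)%g => //; rewrite conjgM /conjg mulgA.
apply: lb_le_inf; first by exists (len g), g => //; exists 1%g => //; rewrite conjg1.
by move=> _ [f Hf <-]; exact: Hx.
Qed.

Lemma conj_class_conj g x : conj_class (g ^ x)%g = conj_class g.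
Proof.
apply/seteqP; split=> _ [y _ <-].
  by exists (x * y)%g => //; rewrite conjgM.
by exists (x^-1 * y)%g => //; rewrite -conjgM mulVKg.
Qed.

(** The infimum that defines the length of the class is attained at a shortest
    element, to which [shortest_trichotomy] applies. *)
Lemma non_contracting_class_rep X E C (n : R) (k : set G) :
  barrier_axis a o X E C -> proper_space Y -> proper_action a ->
  (exists2 g, non_contracting a o g & k = conj_class g) ->
  conj_length a o k <= n ->
  exists2 g, k = conj_class g & (len g <= n /\ barrier_free a o X (20 * C) g)
    \/ (E g /\ len g <= n + C).
Proof.
move=> AX PY Pa [g Ng ->] gn.
have [x Hx xg] := shortest_in_class g PY Pa.
have xn := le_trans xg gn.
case: (shortest_trichotomy AX Hx) => [Bx|[f [Ef fx]]|ct].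
- by exists (g ^ x)%g; [rewrite conj_class_conj|left].
- exists ((g ^ x) ^ f)%g; first by rewrite !conj_class_conj.
  by right; rewrite /conjg mulgA; split=> //; rewrite /conjg in fx xn *; lra.
- by case: Ng; have := ct x; rewrite {1}/conjg mulVKg mulgK.
Qed.

End Entropy.

Theorem mainTheorem9 (R : realType) (G : groupType) (Y : metricType R)
    (a : isometric_action G Y) (o : Y) :
  countable [set: G] ->
  non_elementary G ->
  proper_space Y ->
  geodesic_space Y ->
  proper_action a ->
  SCC a o ->
  (exists h : G, contracting_element a o h) ->
  (omega_conj a o (non_contracting a o) < omega a o [set: G])%E.
Proof.
move=> _ _ PY HY Pa [M1 [M2 [M10 M12 gap]]] [h Hh].
have {}M10 : 0 <= M1 by exact: ltW.
have [E [C [AX [A A0 HA]]]] := axis_barrier PY HY Pa Hh.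
have C1 := axis_ge1 AX.
have wfin := omega_finite PY HY Pa M10 M12 gap.
have O0 : (0 <= omega a o (concave_region a o M1 M2))%E.
  apply: (growth_ge0 (x := 1%g)) => n; split; last by apply: concave1; lra.
  by rewrite /orbit_ball /= act1 mdistxx.
have [w Ew] : exists w, omega a o [set: G] = w%:E.
  case: (omega a o [set: G]) wfin gap => [w|//|]; first by exists w.
  by move=> _; rewrite ltNge leNye.
have [r Er] : exists r, omega a o (concave_region a o M1 M2) = r%:E.
  case: (omega a o (concave_region a o M1 M2)) O0 gap => [r|_|//]; first by exists r.
  by rewrite ltNge leey.
rewrite Er Ew lte_fin in gap; rewrite Er lee_fin in O0.
(* Counting the concave region at the exponent [v] gives convergence at [s0], and
   [s0 < w] leaves room to decrease [w]. *)
pose v := r + (w - r) / 4; pose s0 := r + (w - r) / 2.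
have HG s : w < s ->
    exists S, sum_bound [set: G] (fun g => expR (- s * mdist o (a g o))) S.
  move=> ws; apply: (@growth_card_series _ _ _ _ _ _ (w + (s - w) / 2)).
  - by lra.
  - by lra.
  - by rewrite Ew lte_fin; lra.
have HO : exists S, sum_bound (concave_region a o M1 M2)
    (fun g => expR (- s0 * mdist o (a g o))) S.
  apply: (@growth_card_series _ _ _ _ _ _ v); rewrite ?Er ?lte_fin /s0 /v; lra.
have s00 : 0 < s0 by rewrite /s0; lra.
have s0w : s0 < w by rewrite /s0; lra.
have K0 : 0 <= 20 * C by lra.
have [s [D [s0s sw D0 HD]]] :=
  barrier_free_growth AX PY HY Pa M10 M12 K0 (ltW s00) s0w HG HO.
have spos : 0 < s by lra.
rewrite Ew; apply: (@le_lt_trans _ _ (s + (w - s) / 2)%:E); last first.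
  by rewrite lte_fin; lra.
pose D' := D + A * ((1 + C) * (1 + s^-1)).
apply: (@card_growth_le _ _ _ D' s); first by lra.
move=> n l ul Hl.
have : forall k : set G, exists g, k \in l -> k = conj_class g /\
    ((mdist o (a g o) <= n%:R /\ barrier_free a o (axis a o h) (20 * C) g) \/
     (E g /\ mdist o (a g o) <= n%:R + C)).
  move=> k; case: (boolP (k \in l)) => [/Hl[Hk kn]|_]; last by exists 1%g.
  by have [g Ek Hg] := non_contracting_class_rep AX PY Pa Hk kn; exists g.
move=> /choice[rep Hrep].
pose m := map rep l.
have um : uniq m.
  rewrite map_inj_in_uniq // => k k' /Hrep[Ek _] /Hrep[Ek' _] kk'.
  by rewrite Ek Ek' kk'.
pose Z := [pred g : G | `[< mdist o (a g o) <= n%:R /\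
  barrier_free a o (axis a o h) (20 * C) g >]].
rewrite -(size_map rep) -/m -(count_predC Z m) natrD -!size_filter.
have B1 : (size [seq g <- m | Z g])%:R <= D * expR (s * n%:R).
  apply: HD; first exact: filter_uniq.
  by move=> g; rewrite mem_filter => /andP[/asboolP].
have B2 : (size [seq g <- m | predC Z g])%:R <= A * (1 + (n%:R + C)).
  apply: HA; first by have := ler0n R n; lra.
    exact: filter_uniq.
  move=> g; rewrite mem_filter => /andP[/asboolP nZ /mapP[k kl Eg]].
  by case: (Hrep k kl) => _; rewrite -Eg => -[].
have sV : 0 < s^-1 by rewrite invr_gt0.
have sn : 0 <= s * n%:R by apply: mulr_ge0 => //; exact: ltW.
have B3 : A * (1 + (n%:R + C)) <= A * ((1 + C) * (1 + s^-1)) * expR (s * n%:R).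
  rewrite -mulrA; apply: ler_wpM2l => //.
  have Cn : 0 <= C * n%:R by apply: mulr_ge0; lra || exact: ler0n.
  apply: (@le_trans _ _ ((1 + C) * (1 + n%:R))); first by lra.
  rewrite -mulrA; apply: ler_wpM2l; first by lra.
  apply: (@le_trans _ _ ((1 + s^-1) * (1 + s * n%:R))).
    by rewrite mulrDl mul1r mulrDr mulr1 mulrA mulVf ?gt_eqF// mul1r; lra.
  by apply: ler_wpM2l; [lra|apply: expR_ge1Dx; lra].
by rewrite /D' mulrDl; lra.
Qed.
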